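(* Let $\beta>1$, $\mathbf{b}\in\mathbb{C}^n\setminus\{0\}$ and $L\in Q_{\mathbf{b},\beta}(\mathbb{B}_n)$. A function $F$ analytic in $\mathbb{B}_n$ is of bounded $L$-index in the direction $\mathbf{b}$ if and only if there exist $p\in\mathbb{Z}_+$ and $C>0$ such that for every $z\in\mathbb{B}_n$ $$\left|\frac{1}{L^{p+1}(z)}\frac{\partial^{p+1}F(z)}{\partial\mathbf{b}^{p+1}}\right|\le C\max\left\{\left|\frac{1}{L^k(z)}\frac{\partial^kF(z)}{\partial\mathbf{b}^k}\right|:\ 0\le k\le p\right\}.$$
   Context: $|\cdot|$ is the Euclidean norm on $\mathbb{C}^n$, $\mathbb{B}_n=\{z\in\mathbb{C}^n:|z|<1\}$, $\mathbb{R}_+=(0,\infty)$, $\mathbb{Z}_+=\{0,1,2,\dots\}$. For $z\in\mathbb{C}^n$, $S_z=\{t\in\mathbb{C}: z+t\mathbf{b}\in\mathbb{B}_n\}$. Directional derivatives: $\frac{\partial^0F}{\partial\mathbf{b}^0}=F$, $\frac{\partial F}{\partial\mathbf{b}}=\sum_{j=1}^n\frac{\partial F}{\partial z_j}b_j$, $\frac{\partial^kF}{\partial\mathbf{b}^k}=\frac{\partial}{\partial\mathbf{b}}\big(\frac{\partial^{k-1}F}{\partial\mathbf{b}^{k-1}}\big)$ for $k\ge2$. For a positive continuous $L$ on $\mathbb{B}_n$, an analytic function $F$ in $\mathbb{B}_n$ is of bounded $L$-index in the direction $\mathbf{b}$ if there is $m_0\in\mathbb{Z}_+$ such that for all $m\in\mathbb{Z}_+$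 and all $z\in\mathbb{B}_n$ $$\frac{1}{m!L^m(z)}\left|\frac{\partial^mF(z)}{\partial\mathbf{b}^m}\right|\le\max\left\{\frac{1}{k!L^k(z)}\left|\frac{\partial^kF(z)}{\partial\mathbf{b}^k}\right|:0\le k\le m_0\right\}.$$ Class $Q_{\mathbf{b},\beta}(\mathbb{B}_n)$: the set of continuous $L:\mathbb{B}_n\to\mathbb{R}_+$ with $L(z)>\frac{\beta|\mathbf{b}|}{1-|z|}$ for all $z\in\mathbb{B}_n$ and such that $0<\lambda_1^{\mathbf{b}}(\eta)\le\lambda_2^{\mathbf{b}}(\eta)<+\infty$ for every $\eta\in[0,\beta]$, where $\lambda_1^{\mathbf{b}}(\eta)$ and $\lambda_2^{\mathbf{b}}(\eta)$ are respectively the infimum and the supremum of $\frac{L(z+t\mathbf{b})}{L(z+t_0\mathbf{b})}$ over all $z\in\mathbb{B}_n$, $t_0\in S_z$ and $t\in\mathbb{C}$ with $|t-t_0|\le\frac{\eta}{L(z+t_0\mathbf{b})}$ (for such $t$ one has $z+t\mathbf{b}\in\mathbb{B}_n$). *)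

(* Defs.v *)
From HB Require Import structures.
From mathcomp Require Import all_boot all_order all_algebra finmap complex.
From mathcomp Require Import all_classical all_reals all_analysis.
(* Not imported: its [sum] and [summable] would shadow other library names. *)
From mathcomp Require summability.

Set Implicit Arguments.
Unset Strict Implicit.
Unset Printing Implicit Defensive.

Import Order.TTheory GRing.Theory Num.Theory.
Import numFieldNormedType.Exports.
Local Open Scope classical_set_scope.
Local Open Scope complex_scope.
Local Open Scope ring_scope.

(* The complex numbers, as a numFieldType: it is on abstract numFieldTypes that
   the library defines the normed topology used for limits and derivatives. *)
Definition Cx (R : realType) : numFieldType := R[i].

(* R-valued modulus; the norm `|z| of Cx R takes its values in Cx R. *)
Definition cabs (R : realType) (z : Cx R) : R := ComplexField.Normc.normc z.

(* The norm `|z| of 'rV_n is the sup norm, hence this definition. *)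
Definition enorm (R : realType) (n : nat) (z : 'rV[Cx R]_n) : R :=
  Num.sqrt (\sum_(j < n) cabs (z 0 j) ^+ 2).

Definition unit_ball (R : realType) (n : nat) : set 'rV[Cx R]_n :=
  [set z | enorm z < 1].
Arguments unit_ball : clear implicits.

(* The finite partial sums of the power series in n variables centered at z,
   evaluated at w; the multi-indices are the functions a : {ffun 'I_n -> nat}. *)
Definition power_series (R : realType) (n : nat)
    (c : {ffun 'I_n -> nat} -> Cx R) (z w : 'rV[Cx R]_n) :
    {fset {ffun 'I_n -> nat}} -> Cx R :=
  summability.partial_sum
    (fun a : {ffun 'I_n -> nat} => c a * \prod_(j < n) (w 0 j - z 0 j) ^+ a j).

(* Near each point of D, F is the sum of a power series.  The series is summed
   along the net of all finite sets of multi-indices, which for complex terms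
   is the same as absolute convergence.  For open D only the values of F on D
   matter. *)
Definition analytic_in (R : realType) (n : nat) (D : set 'rV[Cx R]_n)
    (F : 'rV[Cx R]_n -> Cx R) : Prop :=
  forall z, D z -> exists c : {ffun 'I_n -> nat} -> Cx R,
    \forall w \near z, power_series c z w @ summability.totally --> F w.

(* 'D_(delta_mx 0 j) F is the complex partial derivative of F in the j-th
   variable. *)
Definition dirD (R : realType) (n : nat) (b : 'rV[Cx R]_n)
    (F : 'rV[Cx R]_n -> Cx R) : 'rV[Cx R]_n -> Cx R :=
  fun z => \sum_(j < n) 'D_(delta_mx 0 j) F z * b 0 j.

Definition dirDn (R : realType) (n : nat) (b : 'rV[Cx R]_n) (k : nat)
    (F : 'rV[Cx R]_n -> Cx R) : 'rV[Cx R]_n -> Cx R :=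
  iter k (dirD b) F.

(* Here and below the seed 0 of a maximum is harmless: the index set is
   nonempty and the terms are nonnegative wherever L is positive. *)
Definition bounded_L_index (R : realType) (n : nat) (b : 'rV[Cx R]_n)
    (L : 'rV[Cx R]_n -> R) (F : 'rV[Cx R]_n -> Cx R) : Prop :=
  exists m0 : nat, forall (m : nat) (z : 'rV[Cx R]_n), unit_ball R n z ->
    (m`!%:R * L z ^+ m)^-1 * cabs (dirDn b m F z) <=
    \big[Num.max/0]_(k < m0.+1)
      ((k`!%:R * L z ^+ k)^-1 * cabs (dirDn b k F z)).

Definition slice (R : realType) (n : nat) (b z : 'rV[Cx R]_n) : set (Cx R) :=
  [set t | unit_ball R n (z + t *: b)].

Definition ratios (R : realType) (n : nat) (b : 'rV[Cx R]_n)
    (L : 'rV[Cx R]_n -> R) (eta : R) : set (\bar R) :=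
  [set r | exists z t0 t,
    [/\ unit_ball R n z, slice b z t0,
        cabs (t - t0) <= eta / L (z + t0 *: b)
      & r = (L (z + t *: b) / L (z + t0 *: b))%:E]].

Definition lambda1 (R : realType) (n : nat) (b : 'rV[Cx R]_n)
    (L : 'rV[Cx R]_n -> R) (eta : R) : \bar R := ereal_inf (ratios b L eta).

Definition lambda2 (R : realType) (n : nat) (b : 'rV[Cx R]_n)
    (L : 'rV[Cx R]_n -> R) (eta : R) : \bar R := ereal_sup (ratios b L eta).

(* L is a total function, of which only the values on the ball matter: under
   the growth condition the points z + t *: b in [ratios] lie in the ball as
   soon as 0 <= eta <= beta. *)
Definition classQ (R : realType) (n : nat) (b : 'rV[Cx R]_n) (beta : R)
    (L : 'rV[Cx R]_n -> R) : Prop :=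
  [/\ {within unit_ball R n, continuous L},
      forall z, unit_ball R n z -> 0 < L z,
      forall z, unit_ball R n z -> beta * enorm b / (1 - enorm z) < L z
    & forall eta : R, 0 <= eta <= beta ->
        [/\ (0 < lambda1 b L eta)%E,
            (lambda1 b L eta <= lambda2 b L eta)%E
          & (lambda2 b L eta < +oo)%E]].

(* Main.v *)
(* Fix z in the ball and rescale the slice through z by h(s) = F(z + (s / L z) b).
   On the disc |s| < beta the values of L are at most a constant times L z, so
   the hypothesis becomes |h^(p+1)| <= C' max_(k <= p) |h^(k)| there, and by
   Gronwall's inequality along rays |h| <= K max_(k <= p) |h^(k)(0)|.
   Cauchy's estimate on a circle of radius r with 1 < r < beta then gives
   |h^(m)(0)| / m! <= K r^-m max_(k <= p) |h^(k)(0)|, and r^-m absorbs the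
   constant K p! for all large m.  The converse is immediate.

   Cauchy's estimate is obtained without integration, from the maximum
   principle applied to an average over roots of unity.  That the iterated
   partial derivatives of F are the derivatives of its slices is read off from
   a class of limits of polynomials which is stable under differentiation. *)

Require Import Defs.
From HB Require Import structures.
From mathcomp Require Import all_boot all_order all_algebra finmap complex.
From mathcomp Require Import all_classical all_reals all_analysis.
From mathcomp Require Import ring lra.
From mathcomp Require summability cyclic separable cyclotomic.

Set Implicit Arguments.
Unset Strict Implicit.
Unset Printing Implicit Defensive.

Import Order.TTheory GRing.Theory Num.Theory.
Import numFieldNormedType.Exports.
Local Open Scope classical_set_scope.
Local Open Scope complex_scope.
Local Open Scope ring_scope.

Local Notation Re := complex.Re.
Local Notation Im := complex.Im.

(** * The modulus *)

Section Modulus.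
Variable R : realType.
Implicit Types z w : Cx R.

(** Complex differentiability is expressed by a quadratic remainder bound, which power series
    satisfy directly and which products, rays and rescaling preserve with explicit constants; a
    function is carried together with the sequence of its successive derivatives. Gronwall's
    inequality needs a differentiable quantity, so the maximum of the moduli gives way to the sum of
    their squares. The constant obtained depends on [p], [beta], [C] and the ratio bound of [L],
    never on [z]; this uniformity is what makes a single index possible. The assumption [1 < beta]
    leaves room for the radius of the circle: above 1 for geometric decay, below [beta] so that the
    closed disc stays where the differential inequality holds. The maximum principle asks only for
    polynomial approximation of order 3, because sums over four points already detect the
    Laplacian. *)

Lemma cabs_ge0 z : 0 <= cabs z.
Proof. by case: z => x y; exact: sqrtr_ge0. Qed.

Lemma cabs0 : cabs (0 : Cx R) = 0.
Proof. exact: ComplexField.Normc.normc0. Qed.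

Lemma cabs1 : cabs (1 : Cx R) = 1.
Proof. exact: ComplexField.Normc.normc1. Qed.

Lemma cabsM z w : cabs (z * w) = cabs z * cabs w.
Proof. exact: ComplexField.Normc.normcM. Qed.

Lemma cabsN z : cabs (- z) = cabs z.
Proof. exact: normcN. Qed.

Lemma cabsD z w : cabs (z + w) <= cabs z + cabs w.
Proof. exact: le_normcD. Qed.

Lemma cabsV z : cabs z^-1 = (cabs z)^-1.
Proof. exact: ComplexField.Normc.normcV. Qed.

Lemma cabs_eq0 z : (cabs z == 0) = (z == 0).
Proof.
apply/eqP/eqP => [|->]; last exact: cabs0.
exact: ComplexField.Normc.eq0_normc.
Qed.

Lemma cabs_gt0 z : (0 < cabs z) = (z != 0).
Proof. by rewrite lt_def cabs_ge0 andbT cabs_eq0. Qed.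

Lemma cabsB z w : cabs (z - w) <= cabs z + cabs w.
Proof. by rewrite -(cabsN w) cabsD. Qed.

Lemma cabs_distC z w : cabs (z - w) = cabs (w - z).
Proof. by rewrite -cabsN opprB. Qed.

Lemma cabsX z k : cabs (z ^+ k) = cabs z ^+ k.
Proof. by elim: k => [|k IH]; rewrite ?expr0 ?cabs1// !exprS cabsM IH. Qed.

Lemma cabs_real (x : R) : cabs (x%:C : Cx R) = `|x|.
Proof. by rewrite /cabs /= expr0n/= addr0 sqrtr_sqr. Qed.

Lemma cabs_nat k : cabs (k%:R : Cx R) = k%:R.
Proof.
have -> : (k%:R : Cx R) = (k%:R : R)%:C by rewrite rmorph_nat.
by rewrite cabs_real ger0_norm.
Qed.

Lemma cabs_i : cabs ('i : Cx R) = 1.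
Proof. by rewrite /cabs /= expr0n/= expr1n add0r sqrtr1. Qed.

Lemma norm_cabs z : `|z| = (cabs z)%:C :> Cx R.
Proof. by []. Qed.

Lemma sqr_cabs z : cabs z ^+ 2 = Re z ^+ 2 + Im z ^+ 2.
Proof. by case: z => x y /=; rewrite sqr_sqrtr// addr_ge0 ?sqr_ge0. Qed.

Lemma normr_Re_cabs z : `|Re z| <= cabs z.
Proof.
by rewrite -(@ler_pXn2r _ 2) ?nnegrE ?normr_ge0 ?cabs_ge0// sqr_cabs
  real_normK ?num_real// lerDl sqr_ge0.
Qed.

Lemma normr_Im_cabs z : `|Im z| <= cabs z.
Proof.
by rewrite -(@ler_pXn2r _ 2) ?nnegrE ?normr_ge0 ?cabs_ge0// sqr_cabs
  real_normK ?num_real// lerDr sqr_ge0.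
Qed.

Lemma cabs_le_ReIm z : cabs z <= `|Re z| + `|Im z|.
Proof.
rewrite -(@ler_pXn2r _ 2) ?nnegrE ?addr_ge0 ?cabs_ge0// sqr_cabs.
rewrite sqrrD !real_normK ?num_real// -addrA lerD2l lerDr.
by rewrite mulrn_wge0// mulr_ge0.
Qed.

Lemma cabs_sum (I : Type) (r : seq I) (P : pred I) (f : I -> Cx R) :
  cabs (\sum_(i <- r | P i) f i) <= \sum_(i <- r | P i) cabs (f i).
Proof.
elim/big_ind2: _ => [|x1 x2 y1 y2 h1 h2|//]; first by rewrite cabs0.
by apply: le_trans (cabsD _ _) _; rewrite lerD.
Qed.

Lemma ReD z w : Re (z + w) = Re z + Re w.
Proof. by case: z; case: w. Qed.

Lemma ReN z : Re (- z) = - Re z.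
Proof. by case: z. Qed.

Lemma ImD z w : Im (z + w) = Im z + Im w.
Proof. by case: z; case: w. Qed.

Lemma ImN z : Im (- z) = - Im z.
Proof. by case: z. Qed.

Lemma Re_realM (x : R) z : Re ((x%:C : Cx R) * z) = x * Re z.
Proof. by case: z => a b /=; rewrite mul0r subr0. Qed.

End Modulus.

(** * Local polynomial approximation *)

Section Approx.
Variable R : realType.
Implicit Types (f g : Cx R -> Cx R) (x c d s : Cx R) (p q : {poly Cx R}).

(** Order 2 will stand for a derivative, order 3 feeds the maximum principle, and order [m.+3] feeds
    Cauchy's estimate. No sign is asked of [K]. *)
Definition approx (N : nat) f x p := exists K delta : R, 0 < delta /\
  forall s, cabs s < delta -> cabs (f (x + s) - p.[s]) <= K * cabs s ^+ N.

Lemma horner_bounded p :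
  exists K : R, 0 <= K /\ forall s, cabs s <= 1 -> cabs p.[s] <= K.
Proof.
elim/poly_ind: p => [|p c [K [K0 HK]]].
  by exists 0; split=> // s _; rewrite horner0 cabs0.
exists (K + cabs c); split=> [|s s1]; first by rewrite addr_ge0 ?cabs_ge0.
rewrite hornerMXaddC (le_trans (cabsD _ _))// lerD2r cabsM -[leRHS]mulr1.
by rewrite ler_pM ?cabs_ge0 ?HK.
Qed.

(** A normal form for multiplying remainders: [0 <= K] makes them monotone, and [delta <= 1] lets a
    fixed polynomial be bounded on the disc. *)
Lemma approxP N f x p : approx N f x p <->
  exists K delta : R, [/\ 0 <= K, 0 < delta, delta <= 1 &
  forall s, cabs s < delta -> cabs (f (x + s) - p.[s]) <= K * cabs s ^+ N].
Proof.
split=> [[K [e [e0 H]]]|[K [e [_ e0 _ H]]]]; last by exists K, e.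
exists `|K|, (Num.min e 1); split=> [//||| s].
- by rewrite lt_min e0 ltr01.
- by rewrite ge_min lexx orbT.
- rewrite lt_min => /andP[se _]; apply: le_trans (H s se) _.
  by rewrite ler_wpM2r ?exprn_ge0 ?cabs_ge0 ?ler_norm.
Qed.

Lemma approx_near_ext N f g x p (r : R) : 0 < r ->
  (forall s, cabs s < r -> f (x + s) = g (x + s)) ->
  approx N f x p -> approx N g x p.
Proof.
move=> r0 fg [K [e [e0 H]]]; exists K, (Num.min e r); split.
  by rewrite lt_min e0 r0.
by move=> s; rewrite lt_min => /andP[se sr]; rewrite -fg// H.
Qed.

Lemma approx_cst N x c : approx N (fun=> c) x c%:P.
Proof. by exists 0, 1; split=> // s _; rewrite hornerC subrr cabs0 mul0r. Qed.

Lemma approx_id N x : approx N id x (x%:P + 'X).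
Proof.
by exists 0, 1; split=> // s _; rewrite hornerD hornerC hornerX subrr cabs0 mul0r.
Qed.

Lemma approxD N f g x p q : approx N f x p -> approx N g x q ->
  approx N (fun s => f s + g s) x (p + q).
Proof.
move=> [K [e [e0 H]]] [K' [e' [e'0 H']]]; exists (K + K'), (Num.min e e').
split=> [|s]; first by rewrite lt_min e0.
rewrite lt_min => /andP[se se']; rewrite hornerD mulrDl.
have -> : f (x + s) + g (x + s) - (p.[s] + q.[s]) =
  (f (x + s) - p.[s]) + (g (x + s) - q.[s]) by ring.
by rewrite (le_trans (cabsD _ _))// lerD ?H ?H'.
Qed.

Lemma approxM N f g x p q : approx N f x p -> approx N g x q ->
  approx N (fun s => f s * g s) x (p * q).
Proof.
move=> /approxP[K [e [K0 e0 e1 H]]] /approxP[K' [e' [K'0 e'0 e'1 H']]].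
have [A [A0 HA]] := horner_bounded p; have [B [B0 HB]] := horner_bounded q.
(* On the unit disc [A] bounds [p], and [B + K'] bounds [g] through [q] plus its remainder. *)
exists (K * (B + K') + A * K'), (Num.min e e').
split=> [|s]; first by rewrite lt_min e0.
rewrite lt_min => /andP[se se']; rewrite hornerM.
have s1 : cabs s <= 1 by rewrite (le_trans (ltW se)).
have -> : f (x + s) * g (x + s) - p.[s] * q.[s] =
  (f (x + s) - p.[s]) * (q.[s] + (g (x + s) - q.[s])) +
  p.[s] * (g (x + s) - q.[s]) by ring.
rewrite (le_trans (cabsD _ _))// [leRHS]mulrDl !cabsM lerD//.
  rewrite -mulrA [(B + K') * _]mulrC mulrA.
  rewrite ler_pM ?cabs_ge0 ?H// (le_trans (cabsD _ _))// lerD ?HB//.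
  rewrite (le_trans (H' _ se'))// -[leRHS]mulr1 ler_wpM2l//.
  by rewrite exprn_ile1 ?cabs_ge0.
by rewrite -mulrA ler_pM ?cabs_ge0 ?HA ?H'.
Qed.

Lemma approx_sum N (I : Type) (r : seq I) (F : I -> Cx R -> Cx R)
    (P : I -> {poly Cx R}) x : (forall i, approx N (F i) x (P i)) ->
  approx N (fun s => \sum_(i <- r) F i s) x (\sum_(i <- r) P i).
Proof.
move=> H; elim: r => [|i r IH].
  rewrite big_nil; apply: (@approx_near_ext _ (fun=> 0) _ _ _ 1) => //.
  - by move=> s _; rewrite big_nil.
  - exact: approx_cst.
rewrite big_cons; apply: (@approx_near_ext _ _ _ _ _ 1 _ _ (approxD (H i) IH)).
  exact: ltr01.
by move=> s _; rewrite big_cons.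
Qed.

Lemma approxX N f x p k : approx N f x p ->
  approx N (fun s => f s ^+ k) x (p ^+ k).
Proof.
move=> H; elim: k => [|k IH].
  apply: (@approx_near_ext _ (fun=> 1) _ _ _ 1) => //; exact: approx_cst.
rewrite exprS; apply: (@approx_near_ext _ _ _ _ _ 1 _ _ (approxM H IH)).
  exact: ltr01.
by move=> s _; rewrite exprS.
Qed.

(** Terms of degree at least [N] are absorbed by the remainder, [r] being bounded on the unit
    disc. *)
Lemma approx_trunc N f x p q r : p = q + r * 'X^N ->
  approx N f x p -> approx N f x q.
Proof.
move=> pq /approxP[K [e [K0 e0 e1 H]]].
have [A [A0 HA]] := horner_bounded r.
exists (K + A), e; split=> // s se.
have -> : f (x + s) - q.[s] = (f (x + s) - p.[s]) + r.[s] * s ^+ N.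
  by rewrite pq hornerD hornerM hornerXn; ring.
rewrite (le_trans (cabsD _ _))// mulrDl lerD ?H// cabsM cabsX.
by rewrite ler_wpM2r ?exprn_ge0 ?cabs_ge0 ?HA// (le_trans (ltW se)).
Qed.

Lemma approx_weaken N M f x p : (N <= M)%N -> approx M f x p -> approx N f x p.
Proof.
move=> NM /approxP[K [e [K0 e0 e1 H]]]; exists K, e; split=> // s se.
rewrite (le_trans (H s se))// ler_wpM2l//.
by rewrite ler_wiXn2l ?cabs_ge0// (le_trans (ltW se)).
Qed.

Lemma approx_scale N f x p c : approx N f (c * x) p ->
  approx N (fun s => f (c * s)) x (p \Po (c%:P * 'X)).
Proof.
move=> [K [e [e0 H]]].
exists (K * cabs c ^+ N), (e / (cabs c + 1)).
have c1 : 0 < cabs c + 1 by rewrite ltr_wpDl ?cabs_ge0.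
split=> [|s]; first by rewrite divr_gt0.
rewrite ltr_pdivlMr// => se.
rewrite horner_comp hornerM hornerC hornerX mulrDr -mulrA -exprMn -cabsM H//.
by rewrite cabsM (le_lt_trans _ se)// mulrC ler_wpM2l ?cabs_ge0// lerDl.
Qed.

Lemma approx_inv x : x != 0 ->
  approx 3 (fun s => s^-1) x
    ((x^-1)%:P - (x^-2)%:P * 'X + (x^-3)%:P * 'X^2).
Proof.
move=> x0; have cx : 0 < cabs x by rewrite cabs_gt0.
exists (cabs x ^- 3 * (cabs x / 2)^-1), (cabs x / 2).
split=> [|s sx]; first by rewrite divr_gt0.
(* The remainder is exactly [- s^3 / (x^3 (x + s))], so it remains to keep [x + s] away from 0. *)
have xs : cabs x / 2 <= cabs (x + s).
  have : cabs x <= cabs (x + s) + cabs s.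
    by rewrite -{1}(addrK s x) cabsB.
  by lra.
have xs0 : x + s != 0.
  by rewrite -cabs_gt0 (lt_le_trans _ xs)// divr_gt0.
rewrite !(hornerD, hornerN, hornerM, hornerC, hornerX, hornerXn).
have -> : (x + s)^-1 - (x^-1 - x^-2 * s + x^-3 * s ^+ 2) =
   - (x ^- 3 * (x + s)^-1 * s ^+ 3) by field; rewrite x0 xs0.
rewrite cabsN 2!cabsM !cabsV !cabsX; apply: ler_wpM2r.
  by rewrite exprn_ge0 ?cabs_ge0.
apply: ler_wpM2l; first by rewrite invr_ge0 exprn_ge0 ?cabs_ge0.
by rewrite lef_pV2// posrE ?divr_gt0// (lt_le_trans _ xs)// divr_gt0.
Qed.

(** Complex differentiability with derivative [d], strengthened to a quadratic remainder. *)
Definition quad_diff f x d := approx 2 f x ((f x)%:P + d%:P * 'X).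

Lemma quad_diff_cst x c : quad_diff (fun=> c) x 0.
Proof. by rewrite /quad_diff polyC0 mul0r addr0; exact: approx_cst. Qed.

Lemma quad_diff_id x : quad_diff id x 1.
Proof. by rewrite /quad_diff mul1r; exact: approx_id. Qed.

Lemma quad_diffD f g x d d' : quad_diff f x d -> quad_diff g x d' ->
  quad_diff (fun s => f s + g s) x (d + d').
Proof.
move=> H H'; rewrite /quad_diff.
have -> : (f x + g x)%:P + (d + d')%:P * 'X =
  ((f x)%:P + d%:P * 'X) + ((g x)%:P + d'%:P * 'X) by rewrite !polyCD; ring.
exact: approxD.
Qed.

Lemma quad_diffM f g x d d' : quad_diff f x d -> quad_diff g x d' ->
  quad_diff (fun s => f s * g s) x (d * g x + f x * d').
Proof.
move=> H H'; apply: approx_trunc (approxM H H') => /=.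
(* The product of the two affine parts exceeds the affine part sought by [d d' X^2]. *)
instantiate (1 := (d * d')%:P).
by rewrite !polyCD !polyCM; ring.
Qed.

Lemma quad_diffZ c f x d : quad_diff f x d ->
  quad_diff (fun s => c * f s) x (c * d).
Proof.
move=> H; have := quad_diffM (quad_diff_cst x c) H.
by rewrite mul0r add0r.
Qed.

Lemma quad_diff_ext f g x d : f =1 g -> quad_diff f x d -> quad_diff g x d.
Proof. by move=> /funext ->. Qed.

End Approx.

(** * Derivatives along rays *)

(** The bridge from quadratic remainders to [is_derive]; the field is general because it serves both
    real derivatives along rays and complex partial derivatives. *)
Lemma is_derive_quad (K : numFieldType) (V W : normedModType K) (f : V -> W)
    (a v : V) (d : W) (C e : K) : 0 <= C -> 0 < e ->
  (forall h : K, `|h| < e ->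
     `|f (h *: v + a) - f a - h *: d| <= C * `|h| ^+ 2) ->
  is_derive a v f d.
Proof.
move=> C0 e0 H.
have cv : (fun h => h^-1 *: ((f \o shift a) (h *: v) - f a)) @ 0^' --> d.
  apply/cvgrPdist_le => eps eps0.
  have C1 : 0 < C + 1 by rewrite ltr_wpDl.
  near=> h.
  have h0 : h != 0 by near: h; exact: nbhs_dnbhs_neq.
  have he : `|h| < e by near: h; exact: dnbhs0_lt.
  have heps : `|h| <= eps / (C + 1).
    by near: h; apply: dnbhs0_le; rewrite divr_gt0.
  have -> : d - h^-1 *: ((f \o shift a) (h *: v) - f a) =
    - (h^-1 *: (f (h *: v + a) - f a - h *: d)).
    by rewrite [in RHS]scalerBr scalerA mulVf// scale1r opprB.
  rewrite normrN normrZ normfV ler_pdivrMl ?normr_gt0//.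
  apply: le_trans (H _ he) _.
  rewrite expr2 mulrCA ler_wpM2l//.
  apply: le_trans (ler_wpM2l C0 heps) _.
  by rewrite mulrA ler_pdivrMr// mulrC ler_wpM2l ?(ltW eps0)// lerDl.
by split; [apply/cvg_ex; exists d | exact/cvg_lim].
Unshelve. all: by end_near.
Qed.

(** [E(x) exp(-C x)] has nonpositive derivative on [[0, 1]]. *)
Lemma gronwall (R : realType) (E dE : R -> R) (C : R) :
  (forall x : R, 0 <= x <= 1 -> is_derive x 1 E (dE x)) ->
  (forall x : R, 0 <= x <= 1 -> dE x <= C * E x) ->
  E 1 <= expR C * E 0.
Proof.
move=> HE le.
have D (x : R) : 0 <= x <= 1 -> is_derive x 1 (E * (fun y => expR (- C * y)))
    ((dE x - C * E x) * expR (- C * x)).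
  move=> x01; have := HE x x01 => HEx.
  apply: is_derive_eq.
  by rewrite /GRing.scale/=; ring.
suff : (E * (fun y => expR (- C * y))) 1 <= (E * (fun y => expR (- C * y))) 0.
  change (E 1 * expR (- C * 1) <= E 0 * expR (- C * 0) -> E 1 <= expR C * E 0).
  rewrite mulr0 expR0 !mulr1 expRN.
  by rewrite ler_pdivrMr ?expR_gt0// mulrC.
have D' (x : R) : x \in `]0, 1[%R -> 0 <= x <= 1.
  by rewrite in_itv/= => /andP[/ltW-> /ltW->].
apply: (@ler0_derive1_nincr _ _ 0 1) => // [x /D' x01|x /D' x01|].
- by have := D x x01 => -[].
- rewrite derive1E; have [_ ->] := D x x01.
  by rewrite mulr_le0_ge0 ?expR_ge0// subr_le0 le.
- apply: derivable_within_continuous => x; rewrite in_itv/= => x01.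
  by have := D x x01 => -[].
Qed.

Section Rays.
Variable R : realType.
Implicit Types (f g : Cx R -> Cx R) (a u c d z : Cx R).

Lemma ray_derive f a u c d (t : R) : quad_diff f (a + t%:C * u) d ->
  is_derive t (1 : R) (fun x : R => Re (c * f (a + x%:C * u))) (Re (c * (d * u))).
Proof.
move=> /approxP[K [e [K0 e0 _ H]]].
pose A := cabs c * K * cabs u ^+ 2.
have A0 : 0 <= A by rewrite !mulr_ge0 ?exprn_ge0 ?cabs_ge0.
have u1 : 0 < cabs u + 1 by rewrite ltr_wpDl ?cabs_ge0.
apply: (@is_derive_quad _ _ _ _ _ _ _ A (e / (cabs u + 1))) => //.
  by rewrite divr_gt0.
move=> h; rewrite ltr_pdivlMr// => hu.
have hue : cabs (h%:C * u) < e.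
  by rewrite cabsM cabs_real (le_lt_trans _ hu)// ler_wpM2l ?lerDl.
have := H _ hue; rewrite !(hornerD, hornerM, hornerC, hornerX) => Hs.
have -> : Re (c * f (a + (h *: (1 : R) + t)%:C * u)) - Re (c * f (a + t%:C * u)) -
   h *: Re (c * (d * u)) =
  Re (c * (f (a + t%:C * u + h%:C * u) -
     (f (a + t%:C * u) + d * (h%:C * u)))).
  have -> : a + (h *: (1 : R) + t)%:C * u = a + t%:C * u + h%:C * u.
    by rewrite /GRing.scale/= mulr1 rmorphD/=; ring.
  rewrite /GRing.scale/= -Re_realM -!ReN -!ReD; congr Re; ring.
apply: le_trans (normr_Re_cabs _) _.
have -> : A * `|h| ^+ 2 = cabs c * (K * (`|h| * cabs u) ^+ 2) by rewrite /A; ring.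
by rewrite cabsM ler_wpM2l ?cabs_ge0// (le_trans Hs)// cabsM cabs_real.
Qed.

Lemma phase z : exists c, cabs c <= 1 /\ Re (c * z) = cabs z.
Proof.
(* At [z = 0] the inverse is 0 by convention and so is this witness, hence [<= 1] rather than an
   equality. *)
exists (z^-1 * (cabs z)%:C).
rewrite cabsM cabsV cabs_real ger0_norm ?cabs_ge0//.
have [->|z0] := eqVneq z 0; first by rewrite mulr0 cabs0 mulr0 ler01.
rewrite mulVf ?cabs_eq0// lexx; split=> //.
by rewrite mulrAC mulVf// mul1r.
Qed.

(** Multiplying by a phase makes the increment a nonnegative real number, and the real mean value
    theorem applies to the real part along the segment. *)
Lemma mean_value_ineq f (df : Cx R -> Cx R) a u (B : R) :
  (forall t : R, 0 <= t <= 1 ->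
     quad_diff f (a + t%:C * u) (df (a + t%:C * u))) ->
  (forall t : R, 0 <= t <= 1 -> cabs (df (a + t%:C * u)) <= B) ->
  cabs (f (a + u) - f a) <= B * cabs u.
Proof.
move=> D le; have [c [c1 <-]] := phase (f (a + u) - f a).
have De t t01 := ray_derive c (D t t01).
have [||x x01] := MVT_segment (@ler01 R) (df := fun t : R =>
    Re (c * (df (a + t%:C * u) * u))) (f := fun t : R => Re (c * f (a + t%:C * u))).
- by move=> x; rewrite in_itv/= => /andP[/ltW x0 /ltW x1]; apply: De; rewrite x0.
- apply: derivable_within_continuous => x; rewrite in_itv/= => x01.
  by have := De x x01 => -[].
rewrite subr0 mulr1 rmorph1 mul1r rmorph0 mul0r addr0 mulrBr ReD ReN => ->.
apply: le_trans (ler_norm _) _; apply: le_trans (normr_Re_cabs _) _.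
rewrite !cabsM -[leRHS]mul1r ler_pM ?mulr_ge0 ?cabs_ge0//.
by rewrite ler_wpM2r ?cabs_ge0// le// -in_itv.
Qed.

End Rays.

(** * Taylor expansion, maximum principle and Cauchy's estimate *)

Section Taylor.
Variable R : realType.
Implicit Types (f : Cx R -> Cx R) (g : nat -> Cx R -> Cx R) (a s x : Cx R).

Lemma quad_diff_shift f a s d :
  quad_diff f (a + s) d -> quad_diff (fun t => f (a + t)) s d.
Proof.
by move=> [K [e [e0 H]]]; exists K, e; split=> // t te; rewrite addrA H.
Qed.

Lemma quad_diff_horner (p : {poly Cx R}) x :
  quad_diff (fun s => p.[s]) x (p^`()).[x].
Proof.
elim/poly_ind: p => [|p c IH].
  rewrite deriv0 horner0; apply: quad_diff_ext (quad_diff_cst x 0) => s.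
  by rewrite horner0.
have := quad_diffD (quad_diffM IH (quad_diff_id x)) (quad_diff_cst x c).
rewrite derivMXaddC hornerD hornerM hornerX mulr1 addr0 addrC.
by apply: quad_diff_ext => s; rewrite hornerMXaddC.
Qed.

(** Here and below [g k] plays the role of the k-th derivative of [g 0]. *)
Definition taylor_poly g a N := \poly_(k < N) (g k a / k`!%:R).

(** Induction on the order for the shifted sequence: the Taylor remainder of [g 0] has that of [g 1]
    as derivative, and the mean value inequality gains one power of [cabs s]. *)
Lemma taylor_approx g a (r : R) N : 0 < r ->
  (forall k s, cabs s < r -> quad_diff (g k) (a + s) (g k.+1 (a + s))) ->
  approx N.+1 (g 0%N) a (taylor_poly g a N.+1).
Proof.
move=> r0; elim: N g => [|N IH] g H.
  have := H 0%N 0; rewrite cabs0 addr0 => /(_ r0) /(approx_weaken (isT : (1 <= 2)%N)).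
  apply: approx_trunc; rewrite expr1; congr (_ + _).
  apply/polyP => i; rewrite coef_poly coefC.
  by case: i => [|i] //=; rewrite fact0 divr1.
have /approxP[K [e [K0 e0 _ HK]]] := IH (fun k => g k.+1) (fun k => H k.+1).
exists K, (Num.min e r); split=> [|s]; first by rewrite lt_min e0.
rewrite lt_min => /andP[se sr].
pose f t := g 0%N (a + t) - (taylor_poly g a N.+2).[t].
pose df t := g 1%N (a + t) - (taylor_poly (fun k => g k.+1) a N.+1).[t].
have dP : (taylor_poly g a N.+2)^`() = taylor_poly (fun k => g k.+1) a N.+1.
  apply/polyP => i; rewrite coef_deriv !coef_poly ltnS.
  case: ifP => // _; last by rewrite mul0rn.
  rewrite factS natrM invfM -[LHS]mulr_natr.
  have : (i.+1%:R : Cx R) != 0 by rewrite pnatr_eq0.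
  by move=> i0; rewrite -mulrA [X in _ * X]mulrAC mulVf// mul1r.
have ts (t : R) : 0 <= t <= 1 -> cabs (t%:C * s) <= cabs s.
  move=> /andP[t0 t1]; rewrite cabsM cabs_real ger0_norm//.
  by rewrite ler_piMl ?cabs_ge0.
have := @mean_value_ineq _ f df 0 s (K * cabs s ^+ N.+1).
rewrite /f add0r !addr0.
have -> : (taylor_poly g a N.+2).[0] = g 0%N a.
  by rewrite horner_coef0 coef_poly fact0 divr1.
rewrite subrr subr0 -mulrA -exprSr; apply=> t t01; rewrite add0r.
  apply: quad_diffD; first exact/quad_diff_shift/H/(le_lt_trans (ts _ t01)).
  rewrite -mulN1r -dP.
  have := quad_diffZ (-1) (quad_diff_horner (taylor_poly g a N.+2) (t%:C * s)).
  by apply: quad_diff_ext => y; rewrite mulN1r.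
apply: le_trans (HK _ (le_lt_trans (ts _ t01) se)) _.
by rewrite ler_wpM2l// lerXn2r ?nnegrE ?cabs_ge0// ts.
Qed.

Lemma approx_at N f x (p : {poly Cx R}) : approx N.+1 f x p -> f x = p.[0].
Proof.
move=> [K [e [e0 H]]]; have := H 0; rewrite cabs0 addr0 => /(_ e0).
rewrite exprS mul0r mulr0 => h; apply/eqP; rewrite -subr_eq0 -cabs_eq0.
by rewrite eq_le h cabs_ge0.
Qed.

Lemma approx_lipschitz N f x (p : {poly Cx R}) : approx N.+1 f x p ->
  exists K e : R, 0 < e /\
    forall s, cabs s < e -> cabs (f (x + s) - f x) <= K * cabs s.
Proof.
move=> fp; have : approx 1 f x (p`_0)%:P.
  apply: approx_trunc (approx_weaken (isT : (1 <= N.+1)%N) fp).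
  instantiate (1 := drop_poly 1 p); rewrite -{1}(poly_take_drop 1 p); congr (_ + _).
  apply/polyP => i; rewrite coef_take_poly coefC.
  by case: i.
move=> fp1; have := approx_at fp1; rewrite hornerC => fx.
move: fp1 => [K [e [e0 H]]]; exists K, e; split=> // s se.
by have := H s se; rewrite hornerC fx.
Qed.

End Taylor.

(** * The maximum principle through a discrete Laplacian *)

Section MaximumPrinciple.
Variable R : realType.
Implicit Types (f : Cx R -> Cx R) (x s : Cx R).

Lemma disc_max (psi : Cx R -> R) (r : R) : 0 <= r ->
  (forall x, cabs x <= r -> exists K e : R, 0 < e /\
     forall s, cabs s < e -> `|psi (x + s) - psi x| <= K * cabs s) ->
  exists2 x0, cabs x0 <= r & forall x, cabs x <= r -> psi x <= psi x0.
Proof.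
move=> r0 H.
(* Compactness is taken in [R * R], where the disc is a closed part of a square; [C] identifies this
   plane with [Cx R]. *)
pose C (y : R * R) : Cx R := Complex y.1 y.2.
pose A : set (R * R) := [set y | y.1 ^+ 2 + y.2 ^+ 2 <= r ^+ 2].
have AE y : A y <-> cabs (C y) <= r.
  by rewrite -(@ler_pXn2r _ 2) ?nnegrE ?cabs_ge0// sqr_cabs.
have cA : compact A.
  apply: (@subclosed_compact _ _ (`[- r, r] `*` `[- r, r])).
  - apply: (@preimage_closed _ _ (fun y : R * R => y.1 ^+ 2 + y.2 ^+ 2)
      [set z | z <= r ^+ 2]); last exact: closed_le.
    move=> y _; apply: cvgD; apply: cvgM; do ?[exact: cvg_fst | exact: cvg_snd].
  - by apply: compact_setX; exact: segment_compact.
  - move=> y /AE yr; split; rewrite /= in_itv/= -ler_norml.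
      exact: le_trans (normr_Re_cabs _) yr.
    exact: le_trans (normr_Im_cabs _) yr.
have [||y Ay ymax] := @compact_EVT_max _ _ (psi \o C) A _ cA.
- by exists (0, 0); rewrite /A/= expr0n/= addr0 exprn_ge0.
- apply: continuous_in_subspaceT => y; rewrite inE => /AE yr.
  have [K [e [e0 HK]]] := H _ yr.
  apply/cvgrPdist_le => eps eps0.
  have K1 : 0 < `|K| + 1 by rewrite ltr_wpDl.
  near=> z.
  have Cz : C z = C y + C (z - y).
    by rewrite /C; case: (y) => y1 y2; case: (z) => z1 z2; congr Complex; ring.
  (* The norm of the product is the maximum over both coordinates, hence the factor 2. *)
  have sz : cabs (C (z - y)) <= 2 * `|y - z|.
    apply: le_trans (cabs_le_ReIm _) _; rewrite (distrC y z) mulr_natl mulr2n.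
    by rewrite /C lerD// prod_normE le_max /= lexx ?orbT.
  have yz1 : `|y - z| < e / 2.
    by near: z; apply: cvgr_dist_lt; [exact: cvg_id|rewrite divr_gt0].
  have yz2 : `|y - z| < eps / (`|K| + 1) / 2.
    by near: z; apply: cvgr_dist_lt; [exact: cvg_id|rewrite !divr_gt0].
  rewrite distrC /= Cz; apply: le_trans (HK _ _) _.
    by apply: le_lt_trans sz _; rewrite mulrC -ltr_pdivlMr.
  apply: (@le_trans _ _ ((`|K| + 1) * cabs (C (z - y)))).
    by rewrite ler_wpM2r ?cabs_ge0// (le_trans (ler_norm _))// lerDl.
  rewrite mulrC -ler_pdivlMr// (le_trans sz)// mulrC -ler_pdivlMr//.
  exact: ltW.
exists (C y); first exact/AE/set_mem.
move=> x xr; have := ymax (Re x, Im x).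
by case: x xr => x1 x2 xr; apply; rewrite inE; apply/AE.
Unshelve. all: by end_near.
Qed.

(** A discrete form of harmonicity: the fourth roots of unity have sum 0, and so have their squares,
    so the linear and quadratic terms cancel. *)
Lemma four_point f x p : approx 3 f x p -> exists K e : R, 0 < e /\
  forall h : R, 0 < h < e ->
  cabs (f (x + h%:C) + f (x - h%:C) + f (x + 'i%C * h%:C) + f (x - 'i%C * h%:C)
    - 4%:R * f x) <= K * h ^+ 3.
Proof.
move=> fp; have : approx 3 f x (take_poly 3 p).
  exact: approx_trunc (esym (poly_take_drop 3 p)) fp.
set q := take_poly 3 p => fq; have := approx_at fq.
have qE s : q.[s] = q`_0 + q`_1 * s + q`_2 * s ^+ 2.
  rewrite (@horner_coef_wide _ 3) ?size_take_poly//.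
  by rewrite !big_ord_recr big_ord0/= add0r expr0 mulr1 expr1.
move: fq => [K [e [e0 H]]].
rewrite qE expr0n/= !mulr0 !addr0 => ->.
exists (4 * K), e; split=> // h /andP[h0 he].
have H' c : cabs c = 1 -> cabs (f (x + c * h%:C) - q.[c * h%:C]) <= K * h ^+ 3.
  by move=> c1; have := H (c * h%:C); rewrite cabsM cabs_real c1 mul1r gtr0_norm//; apply.
have H1 := H' _ (cabs1 R); have Hi := H' _ (cabs_i R).
have Hm1 := H' (-1) (etrans (cabsN 1) (cabs1 R)).
have Hmi := H' (- 'i%C) (etrans (cabsN _) (cabs_i R)).
rewrite !mulNr !mul1r in H1 Hi Hm1 Hmi.
have -> : f (x + h%:C) + f (x - h%:C) + f (x + 'i%C * h%:C) + f (x - 'i%C * h%:C)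
    - 4%:R * q`_0 =
  (f (x + h%:C) - q.[h%:C]) + (f (x - h%:C) - q.[- h%:C]) +
  (f (x + 'i%C * h%:C) - q.['i%C * h%:C]) +
  (f (x - 'i%C * h%:C) - q.[- ('i%C * h%:C)]).
  rewrite !qE !sqrrN exprMn sqr_i; ring.
have tri (a b c d : Cx R) :
    cabs (a + b + c + d) <= cabs a + cabs b + cabs c + cabs d.
  by do 3 (rewrite (le_trans (cabsD _ _))// lerD2r).
apply: le_trans (tri _ _ _ _) _; lra.
Qed.

Lemma cabs_le_phase (c z : Cx R) : cabs c <= 1 -> Re (c * z) <= cabs z.
Proof.
move=> c1; apply: le_trans (ler_norm _) _; apply: le_trans (normr_Re_cabs _) _.
by rewrite cabsM ler_piMl ?cabs_ge0.
Qed.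

(** Suppose [|f 0| > M], with [c] a phase of [f 0]. For small [eps] the function [psi] is larger at
    0 than on the circle, so its maximum is reached at an interior point [x0]. There the four-point
    sum of [Re (c f)] differs from four times its value by [O(h^3)], whereas [eps |x|^2] adds
    exactly [4 eps h^2], which contradicts maximality. *)
Lemma max_principle f (r M : R) : 0 < r ->
  (forall x, cabs x <= r -> exists p, approx 3 f x p) ->
  (forall x, cabs x = r -> cabs (f x) <= M) -> cabs (f 0) <= M.
Proof.
move=> r0 H bd; rewrite leNgt; apply/negP => ltM.
have [c [c1 fc]] := phase (f 0).
pose eps := (cabs (f 0) - M) / (2 * r ^+ 2).
have eps0 : 0 < eps by rewrite divr_gt0 ?subr_gt0// mulr_gt0// exprn_gt0.
have epsr : eps * r ^+ 2 < cabs (f 0) - M.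
  have -> : eps * r ^+ 2 = (cabs (f 0) - M) / 2.
    by rewrite /eps; field; rewrite gt_eqF.
  by rewrite ltr_pdivrMr// ltr_pMr ?subr_gt0// ltr1n.
pose psi x := Re (c * f x) + eps * cabs x ^+ 2.
have [||x0 x0r max] := @disc_max psi r; first exact: ltW.
  move=> x xr; have [p fp] := H x xr.
  have [K [e [e0 HK]]] := approx_lipschitz fp.
  exists (K + eps * (2 * cabs x + 1)), (Num.min e 1).
  split=> [|s]; first by rewrite lt_min e0 ltr01.
  rewrite lt_min => /andP[se s1].
  have -> : psi (x + s) - psi x = Re (c * (f (x + s) - f x)) +
      eps * (cabs (x + s) ^+ 2 - cabs x ^+ 2).
    by rewrite mulrBr ReD ReN /psi; ring.
  apply: le_trans (ler_normD _ _) _; rewrite mulrDl lerD//.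
    apply: le_trans (normr_Re_cabs _) _; rewrite cabsM (le_trans _ (HK _ se))//.
    by rewrite ler_piMl ?cabs_ge0.
  rewrite normrM gtr0_norm// -mulrA ler_wpM2l ?(ltW eps0)//.
  have dist : `|cabs (x + s) - cabs x| <= cabs s.
    have := cabsB (x + s) s; rewrite addrK ler_norml => ?.
    by have := cabsD x s => ?; apply/andP; split; lra.
  rewrite subr_sqr normrM mulrC ler_pM// ger0_norm ?addr_ge0 ?cabs_ge0//.
  by have := cabsD x s; lra.
have x0r' : cabs x0 < r.
  rewrite lt_neqAle x0r andbT; apply/eqP => x0E.
  have := max 0; rewrite cabs0 => /(_ (ltW r0)).
  rewrite /psi cabs0 fc x0E expr0n/= mulr0 addr0.
  have := cabs_le_phase (f x0) c1; have := bd _ x0E; lra.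
have [p fp] := H x0 x0r; have [K [e [e0 HK]]] := four_point fp.
(* The third bound keeps the four points in the disc; the last makes the cubic error smaller than
   [4 eps h^2]. *)
have [h [h0 he hr hK]] : exists h : R, [/\ 0 < h, h < e,
    h <= r - cabs x0 & `|K| * h < 4 * eps].
  have K1 : 0 < `|K| + 1 by rewrite ltr_wpDl.
  have e2 : 0 < e / 2 by rewrite divr_gt0.
  have q0 : 0 < 4 * eps / (`|K| + 1) by apply: divr_gt0 => //; apply: mulr_gt0.
  exists (Num.min (e / 2) (Num.min (r - cabs x0) (4 * eps / (`|K| + 1)))).
  set h := Num.min _ _.
  have h0 : 0 < h by rewrite !lt_min e2 subr_gt0 x0r'.
  have h1 : h <= e / 2 by rewrite ge_min lexx.
  have h2 : h <= r - cabs x0 by rewrite !ge_min lexx orbT.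
  have h3 : h <= 4 * eps / (`|K| + 1) by rewrite !ge_min lexx !orbT.
  split=> //; first by lra.
  by move: h3; rewrite ler_pdivlMr// => h3; nra.
have he' : 0 < h < e by rewrite h0.
have Hc s : cabs s = h -> psi (x0 + s) <= psi x0.
  move=> sh; apply: max; apply: le_trans (cabsD _ _) _; rewrite sh; lra.
have h1 : cabs (h%:C : Cx R) = h by rewrite cabs_real gtr0_norm.
have h2 : cabs ('i%C * h%:C : Cx R) = h by rewrite cabsM cabs_i mul1r.
have h3 : cabs (- (h%:C : Cx R)) = h by rewrite cabsN.
have h4 : cabs (- ('i%C * h%:C : Cx R)) = h by rewrite cabsN.
have := HK h he'; set S := (X in cabs X) => HS.
have : - cabs S <= Re (c * S).
  rewrite lerNl -ReN -mulrN -(cabsN S); exact: cabs_le_phase.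
have -> : Re (c * S) = Re (c * f (x0 + h%:C)) + Re (c * f (x0 - h%:C)) +
    Re (c * f (x0 + 'i%C * h%:C)) + Re (c * f (x0 - 'i%C * h%:C)) -
    4 * Re (c * f x0).
  rewrite -[4 * _](Re_realM) -ReN -!ReD; congr Re.
  by rewrite /S rmorph_nat; ring.
have : cabs (x0 + h%:C) ^+ 2 + cabs (x0 - h%:C) ^+ 2 +
    cabs (x0 + 'i%C * h%:C) ^+ 2 + cabs (x0 - 'i%C * h%:C) ^+ 2 =
    4 * cabs x0 ^+ 2 + 4 * h ^+ 2.
  by rewrite !sqr_cabs; case: (x0) => a b /=; ring.
have := Hc _ h1; have := Hc _ h2; have := Hc _ h3; have := Hc _ h4; rewrite /psi.
have : cabs S < 4 * eps * h ^+ 2.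
  apply: le_lt_trans HS _; apply: le_lt_trans (_ : _ <= `|K| * h * h ^+ 2) _.
    by rewrite -mulrA -exprS ler_wpM2r ?exprn_ge0 ?(ltW h0)// ler_norm.
  by rewrite ltr_pM2r ?exprn_gt0.
move=> L0 L1 L2 L3 L4 L5 L6; nra.
Qed.

End MaximumPrinciple.

(** * Cauchy's estimate by averaging over roots of unity *)

Section CauchyEstimate.
Variable R : realType.
Implicit Types (g : nat -> Cx R -> Cx R) (x s : Cx R).

(** [X^N - 1] splits over the algebraically closed field [R[i]] and is separable in characteristic
    0. *)
Lemma Cx_prim_root_exists N : (0 < N)%N ->
  exists w : Cx R, N.-primitive_root w.
Proof.
pose p : {poly R[i]} := 'X^N - 1; have [r Dp] := closed_field_poly_normal p.
move=> N_gt0; rewrite (monicP _) ?monicXnsubC// scale1r in Dp.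
have rN1 : all N.-unity_root r by apply/allP=> z; rewrite -root_prod_XsubC -Dp.
have sz_r : (N < (size r).+1)%N.
  by rewrite -(size_prod_XsubC r id) -Dp size_XnsubC.
have [|z zr zN] := hasP (cyclic.has_prim_root N_gt0 rN1 _ sz_r); last by exists z.
by rewrite -separable.separable_prod_XsubC -Dp cyclotomic.separable_Xn_sub_1// pnatr_eq0 -lt0n.
Qed.

Lemma cabs_prim_root N (w : Cx R) : N.-primitive_root w -> cabs w = 1.
Proof.
move=> wN; apply/eqP; rewrite -(@pexpr_eq1 _ _ N) ?cabs_ge0//.
  by rewrite -cabsX (prim_expr_order wN) cabs1.
exact: prim_order_gt0 wN.
Qed.

Lemma sum_prim_root N (w : Cx R) k : N.-primitive_root w ->
  \sum_(j < N) w ^+ (k * j) = if (N %| k)%N then N%:R else 0.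
Proof.
move=> wN; have wk : \sum_(j < N) w ^+ (k * j) = \sum_(j < N) (w ^+ k) ^+ j.
  by apply: eq_bigr => j _; rewrite exprM.
rewrite wk; case: ifPn => [/dvdnP[d ->]|nk].
  rewrite (eq_bigr (fun=> 1)); last first.
    by move=> j _; rewrite mulnC exprM (prim_expr_order wN) !expr1n.
  by rewrite sumr_const card_ord.
apply/eqP; have := subrX1 (w ^+ k) N.
rewrite -exprM mulnC exprM (prim_expr_order wN) expr1n subrr => /esym/eqP.
by rewrite mulf_eq0 subr_eq0 -(prim_order_dvd wN) (negPf nk).
Qed.

(* Averaging the values of g 0 over the m.+3 roots of unity kills the Taylor
   coefficients of index <= m.+2 except the m-th one, so the quotient phi of
   this average by 'X^m agrees with its value at 0 up to order 3, and the
   maximum principle applies to phi. *)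
Lemma cauchy_estimate g (r r' M : R) m : 0 < r -> r < r' ->
  (forall k x, cabs x < r' -> quad_diff (g k) x (g k.+1 x)) ->
  (forall x, cabs x = r -> cabs (g 0%N x) <= M) ->
  cabs (g m 0) / m`!%:R * r ^+ m <= M.
Proof.
move=> r0 rr' H bd.
pose N := m.+3; have [w wN] := Cx_prim_root_exists (ltn0Sn m.+2 : (0 < N)%N).
have w1 := cabs_prim_root wN.
have cw (j : nat) : cabs (w ^+ j) = 1 by rewrite cabsX w1 expr1n.
have N0 : (N%:R : Cx R) != 0 by rewrite pnatr_eq0.
pose a k := g k 0 / k`!%:R.
(* As [N = m + 3], the weight [w ^+ (3 * j)] is [w^(-m j)], the character that selects the
   coefficient of index [m]. *)
pose G s := \sum_(j < N) (N%:R^-1 * w ^+ (3 * j)) * g 0%N (w ^+ j * s).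
have GM x : cabs x = r -> cabs (G x) <= M.
  move=> xr; apply: le_trans (cabs_sum _ _ _) _.
  have -> : M = \sum_(j < N) (N%:R^-1 * M).
    rewrite sumr_const card_ord -[RHS]mulr_natl mulrA mulfV ?mul1r//.
    by rewrite pnatr_eq0.
  apply: ler_sum => j _; rewrite !cabsM cabsV cabs_nat cw mulr1.
  by rewrite ler_wpM2l ?invr_ge0// bd// cabsM cw mul1r.
have approxG x : cabs x < r' -> exists P, approx N G x P.
  move=> xr; have rx : 0 < r' - cabs x by rewrite subr_gt0.
  pose P (j : 'I_N) := (N%:R^-1 * w ^+ (3 * j))%:P *
    ((taylor_poly g (w ^+ j * x) N) \Po ((w ^+ j)%:P * 'X)).
  exists (\sum_(j < N) P j).
  apply: (@approx_sum _ N _ _ (fun (j : 'I_N) s =>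
     (N%:R^-1 * w ^+ (3 * j)) * g 0%N (w ^+ j * s)) P x) => j.
  apply: approxM (approx_cst _ _ _) _; apply: approx_scale.
  apply: (@taylor_approx _ g _ _ m.+2 rx) => k s sr; apply: H.
  apply: le_lt_trans (cabsD _ _) _; rewrite cabsM cw mul1r; lra.
have approx0 : exists K e : R, 0 < e /\
    forall s, cabs s < e -> cabs (G s - a m * s ^+ m) <= K * cabs s ^+ N.
  have /approxP[K [e [K0 e0 _ HK]]] : approx N (g 0%N) 0 (taylor_poly g 0 N).
    apply: (@taylor_approx _ g 0 r' m.+2 (lt_trans r0 rr')) => k s; rewrite add0r; exact: H.
  exists K, e; split=> // s se.
  have -> : a m * s ^+ m =
      \sum_(j < N) (N%:R^-1 * w ^+ (3 * j)) * (taylor_poly g 0 N).[w ^+ j * s].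
    transitivity (\sum_(k < N) a k * s ^+ k *
        (N%:R^-1 * \sum_(j < N) w ^+ ((k + 3) * j))); last first.
      rewrite (eq_bigr (fun k : 'I_N => \sum_(j < N) a k * s ^+ k *
          (N%:R^-1 * w ^+ ((k + 3) * j)))); last first.
        by move=> k _; rewrite !mulr_sumr.
      rewrite exchange_big; apply: eq_bigr => j _ /=.
      rewrite horner_poly mulr_sumr; apply: eq_bigr => k _.
      by rewrite exprMn -exprM mulnDl exprD [(k * j)%N]mulnC /a; ring.
    have mN : (m < N)%N by rewrite /N ltnS leqW.
    rewrite (bigD1 (Ordinal mN))//= (sum_prim_root _ wN) /N addn3 dvdnn.
    rewrite mulVf// mulr1 big1 ?addr0// => k km.
    rewrite (sum_prim_root _ wN) ifN ?mulr0//.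
    apply: contra km => /dvdnP[d]; rewrite -val_eqE/= => kd.
    (* A multiple of [N] equal to [k + 3] with [k < N] can only be [N] itself, that is [k = m]. *)
    have kN := ltn_ord k; case: d kd => [|[|d]].
    - by rewrite addn3.
    - by rewrite mul1n addn3 => -[->].
    - move=> kd; have := leq_add kN (isT : (3 <= m.+3)%N).
      by rewrite addSn kd !mulSn addnA ltnNge leq_addr.
  rewrite /G -sumrB; apply: le_trans (cabs_sum _ _ _) _.
  have -> : K * cabs s ^+ N = \sum_(j < N) (N%:R^-1 * (K * cabs s ^+ N)).
    rewrite sumr_const card_ord -[RHS]mulr_natl mulrA mulfV ?mul1r//.
    by rewrite pnatr_eq0.
  apply: ler_sum => j _; rewrite -mulrBr !cabsM cabsV cabs_nat cw mulr1.
  rewrite ler_wpM2l ?invr_ge0//.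
  by have := HK (w ^+ j * s); rewrite add0r cabsM cw mul1r; apply.
pose phi s := if s == 0 then a m else G s * s^-1 ^+ m.
have : cabs (phi 0) <= M / r ^+ m.
  apply: (max_principle r0) => x xr; last first.
    rewrite /phi ifN; last by rewrite -cabs_gt0 xr.
    rewrite cabsM cabsX cabsV xr exprVn ler_wpM2r ?invr_ge0 ?exprn_ge0 ?(ltW r0)//.
    exact: GM.
  have [->|x0] := eqVneq x 0.
    exists (a m)%:P; move: approx0 => [K [e [e0 HK]]].
    exists `|K|, e; split=> // s se; rewrite add0r hornerC /phi.
    case: eqP => [->|/eqP s0]; first by rewrite subrr cabs0 mulr_ge0 ?exprn_ge0.
    have -> : G s * s^-1 ^+ m - a m = s ^- m * (G s - a m * s ^+ m).
      rewrite exprVn mulrBr [s ^- m * (a m * _)]mulrC mulfK ?expf_neq0//.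
      by rewrite mulrC.
    rewrite cabsM cabsV cabsX ler_pdivrMl ?exprn_gt0 ?cabs_gt0//.
    apply: le_trans (HK _ se) _; rewrite /N -addn3 exprD mulrA [leRHS]mulrCA mulrA.
    by rewrite ler_wpM2r// ?ler_wpM2r ?exprn_ge0 ?cabs_ge0 ?ler_norm.
  have [P GP] := approxG x (le_lt_trans xr rr').
  exists (P * ((x^-1)%:P - (x^-2)%:P * 'X + (x^-3)%:P * 'X^2) ^+ m).
  have := approxM (approx_weaken (isT : (3 <= N)%N) GP) (approxX m (approx_inv x0)).
  apply: (@approx_near_ext _ _ _ _ _ _ (cabs x)); first by rewrite cabs_gt0.
  move=> s sx; rewrite /phi ifN//.
  apply/negP; rewrite addr_eq0 => /eqP xs.
  by move: sx; rewrite xs cabsN ltxx.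
rewrite /phi eqxx /a cabsM cabsV cabs_nat ler_pdivlMr// exprn_gt0//.
Qed.

End CauchyEstimate.

(** * Growth of solutions of a differential inequality *)

Section Growth.
Variable R : realType.
Implicit Types (f : Cx R -> Cx R) (g : nat -> Cx R -> Cx R) (x u : Cx R).

(** The squared modulus is differentiable even at zeros of [f]. Its two parts come from [ray_derive]
    with factors 1 and [-i], since [Im z = Re (- i z)]. *)
Lemma ray_derive_sqr f u d (t : R) : quad_diff f (t%:C * u) d ->
  is_derive t (1 : R) (fun s : R => cabs (f (s%:C * u)) ^+ 2)
    (2 * (Re (f (t%:C * u)) * Re (d * u) + Im (f (t%:C * u)) * Im (d * u))).
Proof.
rewrite -[X in quad_diff _ X](add0r) => fd.
have ImE (z : Cx R) : Re (- 'i%C * z) = Im z by case: z => a b /=; ring.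
have h1 := ray_derive 1 fd; have h2 := ray_derive (- 'i%C) fd.
have := is_deriveD (is_deriveM h1 h1) (is_deriveM h2 h2).
rewrite /GRing.scale/= !add0r !mul1r !ImE.
set e := (X in is_derive _ _ _ X -> _) => H.
have -> : 2 * (Re (f (t%:C * u)) * Re (d * u) + Im (f (t%:C * u)) * Im (d * u)) = e.
  by rewrite /e; ring.
apply: is_derive_eq => //.
suff -> : (fun s : R => cabs (f (s%:C * u)) ^+ 2) =
  (fun x : R => Re (1 * f (0 + x%:C * u))) * (fun x : R => Re (1 * f (0 + x%:C * u))) +
  (fun x : R => Re (- 'i%C * f (0 + x%:C * u))) *
  (fun x : R => Re (- 'i%C * f (0 + x%:C * u))) by [].
apply/funext => s; rewrite sqr_cabs.
change (Re (f (s%:C * u)) ^+ 2 + Im (f (s%:C * u)) ^+ 2 =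
  Re (1 * f (0 + s%:C * u)) * Re (1 * f (0 + s%:C * u)) +
  Re (- 'i%C * f (0 + s%:C * u)) * Re (- 'i%C * f (0 + s%:C * u))).
by rewrite add0r mul1r !ImE !expr2.
Qed.

(** The order of quantifiers matters: [K] is fixed before [g], so that one constant serves the
    slices through all points. *)
Lemma jet_growth p (C r : R) : 0 < r -> exists K : R, 0 <= K /\
  forall g,
    (forall k x, cabs x < r -> quad_diff (g k) x (g k.+1 x)) ->
    (forall x, cabs x < r ->
      cabs (g p.+1 x) <= C * \big[Num.max/0]_(k < p.+1) cabs (g k x)) ->
    forall u, cabs u < r ->
      cabs (g 0%N u) <= K * \big[Num.max/0]_(k < p.+1) cabs (g k 0).
Proof.
(* In the derivative of [E], [2 |g_k| |g_(k+1)| |u|] is at most [r (|g_k|^2 + |g_(k+1)|^2)]. The sum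
   of the shifted squares is at most [E] plus the last one, itself at most [C^2 E]. *)
move=> r0; pose A := r * (2 + C ^+ 2).
have A0 : 0 <= expR A * p.+1%:R by rewrite mulr_ge0 ?expR_ge0.
(* Gronwall's inequality bounds squares, and [E 0] has [p.+1] terms, each at most the square of the
   maximum. *)
exists (Num.sqrt (expR A * p.+1%:R)); split; first exact: sqrtr_ge0.
move=> g jet le u ur.
pose E (t : R) := \sum_(k < p.+1) cabs (g k (t%:C * u)) ^+ 2.
pose dE (t : R) := \sum_(k < p.+1) 2 *
  (Re (g k (t%:C * u)) * Re (g k.+1 (t%:C * u) * u) +
   Im (g k (t%:C * u)) * Im (g k.+1 (t%:C * u) * u)).
have E0 t : 0 <= E t by apply: sumr_ge0 => k _; exact: sqr_ge0.
have tu (t : R) : 0 <= t <= 1 -> cabs (t%:C * u) < r.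
  move=> /andP[t0 t1]; apply: le_lt_trans ur; rewrite cabsM cabs_real ger0_norm//.
  by rewrite ler_piMl ?cabs_ge0.
have EdE (t : R) : 0 <= t <= 1 -> is_derive t 1 E (dE t).
  move=> t01; have -> : E = \sum_(k < p.+1) (fun s : R => cabs (g k (s%:C * u)) ^+ 2).
    by apply/funext => s; rewrite fct_sumE.
  by apply: is_derive_sum => k; apply: ray_derive_sqr; apply: jet; exact: tu.
have gE (k : 'I_p.+1) t : cabs (g k (t%:C * u)) ^+ 2 <= E t.
  rewrite /E (bigD1 k)//= lerDl; apply: sumr_ge0 => j _; exact: sqr_ge0.
have lastE (t : R) : 0 <= t <= 1 -> cabs (g p.+1 (t%:C * u)) ^+ 2 <= C ^+ 2 * E t.
  move=> t01; set m := \big[Num.max/0]_(k < p.+1) cabs (g k (t%:C * u)).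
  have m0 : 0 <= m by rewrite /m; exact: bigmax_ge_id.
  have mE : m ^+ 2 <= E t.
    rewrite -[leRHS](sqr_sqrtr (E0 t)) lerXn2r ?nnegrE ?sqrtr_ge0//.
    apply: bigmax_le => [|k _]; first exact: sqrtr_ge0.
    by rewrite -[leLHS]ger0_norm ?cabs_ge0// -sqrtr_sqr ler_wsqrtr.
  apply: (@le_trans _ _ ((C * m) ^+ 2)); last by rewrite exprMn ler_wpM2l ?sqr_ge0.
  have h := le _ (tu t t01).
  by rewrite lerXn2r ?nnegrE ?cabs_ge0// (le_trans (cabs_ge0 _) h).
have dEle (t : R) : 0 <= t <= 1 -> dE t <= A * E t.
  move=> t01.
  apply: (@le_trans _ _ (\sum_(k < p.+1) r *
    (cabs (g k (t%:C * u)) ^+ 2 + cabs (g k.+1 (t%:C * u)) ^+ 2))).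
    apply: ler_sum => k _.
    set a := g k _; set b := g _ _.
    have dot (y z : Cx R) : Re y * Re z + Im y * Im z <= cabs y * cabs z.
      apply: le_trans (ler_norm _) _.
      rewrite -(@ler_pXn2r _ 2) ?nnegrE ?mulr_ge0 ?cabs_ge0//.
      rewrite real_normK ?num_real// exprMn !sqr_cabs.
      rewrite -subr_ge0 (_ : _ - _ = (Re y * Im z - Im y * Re z) ^+ 2) ?sqr_ge0//.
      by ring.
    apply: le_trans (ler_wpM2l _ (dot a (b * u))) _ => //.
    rewrite cabsM; apply: (@le_trans _ _ (2 * (cabs a * cabs b) * r)).
      by rewrite -!mulrA !ler_wpM2l ?cabs_ge0// ltW.
    rewrite mulrC ler_wpM2l ?(ltW r0)//.
    rewrite -subr_ge0 (_ : _ - _ = (cabs a - cabs b) ^+ 2) ?sqr_ge0//.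
    by ring.
  rewrite -mulr_sumr /A -mulrA ler_wpM2l ?(ltW r0)// big_split/= -/(E t).
  have : \sum_(i < p.+1) cabs (g i.+1 (t%:C * u)) ^+ 2 <=
     E t + cabs (g p.+1 (t%:C * u)) ^+ 2.
    rewrite /E big_ord_recr/= lerD2r [leRHS]big_ord_recl/=.
    by rewrite ler_wpDl ?sqr_ge0.
  have := lastE t t01; lra.
have := gronwall EdE dEle; rewrite {2}/E rmorph0 mul0r => growth.
set m := \big[Num.max/0]_(k < p.+1) cabs (g k 0).
have m0 : 0 <= m by exact: bigmax_ge_id.
rewrite -(@ler_pXn2r _ 2) ?nnegrE ?mulr_ge0 ?sqrtr_ge0 ?cabs_ge0//.
rewrite exprMn sqr_sqrtr//.
have := gE ord0 1; rewrite rmorph1 mul1r => /le_trans; apply.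
apply: le_trans growth _; rewrite -mulrA ler_wpM2l ?expR_ge0//.
have -> : p.+1%:R * m ^+ 2 = \sum_(k < p.+1) m ^+ 2.
  by rewrite sumr_const card_ord mulr_natl.
apply: ler_sum => k _; rewrite lerXn2r ?nnegrE ?cabs_ge0//.
exact: (le_bigmax _ (fun k : 'I_p.+1 => cabs (g k 0)) k).
Qed.

End Growth.

(** * Derivatives of multivariate power series *)

Section FormalPolynomials.
Variables (R : realType) (n : nat).
Implicit Types (u v b : 'rV[Cx R]_n) (l : seq 'I_n) (r d : R).

Definition small u d := forall j, cabs (u 0 j) <= d.

Lemma smallD u v d d' : small u d -> small v d' -> small (u + v) (d + d').
Proof. by move=> h h' j; rewrite mxE (le_trans (cabsD _ _))// lerD ?h ?h'. Qed.

Lemma small_le u d d' : d <= d' -> small u d -> small u d'.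
Proof. by move=> dd' h j; rewrite (le_trans (h j)). Qed.

Lemma smallZ u d (t : Cx R) : small u d -> small (t *: u) (cabs t * d).
Proof. by move=> h j; rewrite mxE cabsM ler_wpM2l ?cabs_ge0. Qed.

Lemma small0 d : 0 <= d -> small 0 d.
Proof. by move=> d0 j; rewrite mxE cabs0. Qed.

Lemma small_exists u : exists d, 0 < d /\ small u d.
Proof.
exists (\sum_j cabs (u 0 j) + 1); split.
  by rewrite ltr_wpDl// sumr_ge0// => j _; exact: cabs_ge0.
move=> j; rewrite (bigD1 j)//= -addrA lerDl addr_ge0// sumr_ge0// => i _.
exact: cabs_ge0.
Qed.

(** Monomials are encoded as words in the variables, so that the product rule becomes a structural
    recursion; several words may stand for one monomial. *)
Definition mono_eval l u : Cx R := \prod_(j <- l) u 0 j.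

Fixpoint mono_der l u v : Cx R :=
  if l is j :: l' then v 0 j * mono_eval l' u + u 0 j * mono_der l' u v else 0.

(** The derivative of a word in the constant direction [b], kept as a formal polynomial so that
    differentiation can be iterated. *)
Fixpoint dmono b l : seq (Cx R * seq 'I_n) :=
  if l is j :: l' then
    (b 0 j, l') :: [seq (t.1, j :: t.2) | t <- dmono b l']
  else [::].

Definition peval (P : seq (Cx R * seq 'I_n)) u :=
  \sum_(t <- P) t.1 * mono_eval t.2 u.

Definition pder (P : seq (Cx R * seq 'I_n)) u v :=
  \sum_(t <- P) t.1 * mono_der t.2 u v.

Definition dpoly b (P : seq (Cx R * seq 'I_n)) :=
  flatten [seq [seq (t.1 * s.1, s.2) | s <- dmono b t.2] | t <- P].

(** A majorant norm: a weighted sum of the moduli of the coefficients, which controls values and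
    Taylor remainders term by term. *)
Definition pnorm r (P : seq (Cx R * seq 'I_n)) : R :=
  \sum_(t <- P) cabs t.1 * r ^+ size t.2.

Lemma mono_eval_cons j l u : mono_eval (j :: l) u = u 0 j * mono_eval l u.
Proof. exact: big_cons. Qed.

Lemma peval_dmono b l u : peval (dmono b l) u = mono_der l u b.
Proof.
elim: l => [|j l IH] /=; first by rewrite /peval big_nil.
rewrite /peval big_cons big_map/= -IH mulr_sumr; congr (_ + _).
by apply: eq_bigr => t _; rewrite mono_eval_cons mulrCA.
Qed.

Lemma peval_dpoly b P u : peval (dpoly b P) u = pder P u b.
Proof.
rewrite /peval /dpoly /pder big_flatten big_map; apply: eq_bigr => t _.
rewrite big_map -peval_dmono mulr_sumr; apply: eq_bigr => s _.
by rewrite mulrA.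
Qed.

Lemma mono_derD l u v v' :
  mono_der l u (v + v') = mono_der l u v + mono_der l u v'.
Proof.
elim: l => [|j l IH] /=; first by rewrite addr0.
by rewrite IH mxE; ring.
Qed.

Lemma mono_derZ l u (c : Cx R) v : mono_der l u (c *: v) = c * mono_der l u v.
Proof.
elim: l => [|j l IH] /=; first by rewrite mulr0.
by rewrite IH mxE; ring.
Qed.

Lemma pderD P u v v' : pder P u (v + v') = pder P u v + pder P u v'.
Proof.
rewrite /pder -big_split; apply: eq_bigr => t _ /=.
by rewrite mono_derD mulrDr.
Qed.

Lemma pderZ P u (c : Cx R) v : pder P u (c *: v) = c * pder P u v.
Proof.
rewrite /pder mulr_sumr; apply: eq_bigr => t _ /=.
by rewrite mono_derZ mulrCA.
Qed.

Lemma pnorm_ge0 r P : 0 <= r -> 0 <= pnorm r P.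
Proof.
by move=> r0; apply: sumr_ge0 => t _; rewrite mulr_ge0 ?cabs_ge0 ?exprn_ge0.
Qed.

(** The factor [r] on the left avoids the exponent [size l - 1]. *)
Lemma pnorm_dmono b (B r : R) l : small b B -> 0 <= r ->
  r * pnorm r (dmono b l) <= (size l)%:R * B * r ^+ size l.
Proof.
move=> bB r0; elim: l => [|j l IH] /=.
  by rewrite /pnorm big_nil !mul0r mulr0.
rewrite /pnorm big_cons big_map/=.
have -> : \sum_(t <- dmono b l) cabs t.1 * r ^+ (size t.2).+1 =
    r * pnorm r (dmono b l).
  by rewrite /pnorm mulr_sumr; apply: eq_bigr => t _; rewrite exprS mulrCA.
rewrite mulrDr -natr1 !mulrDl mul1r addrC lerD//.
  by rewrite exprS [leRHS]mulrCA ler_wpM2l.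
by rewrite mulrCA -exprS ler_wpM2r ?exprn_ge0.
Qed.

(** Differentiation costs a factor equal to the degree [k], paid for by halving the radius since
    [k <= 2^k]. *)
Lemma pnorm_dpoly b (B r : R) P : small b B -> 0 <= B -> 0 < r ->
  pnorm (r / 2) (dpoly b P) <= B / (r / 2) * pnorm r P.
Proof.
move=> bB B0 r0; have r2 : 0 < r / 2 by rewrite divr_gt0.
rewrite mulrAC ler_pdivlMr// mulrC.
rewrite /pnorm /dpoly big_flatten big_map !mulr_sumr; apply: ler_sum => t _.
rewrite big_map.
have -> : \sum_(j <- dmono b t.2)
    cabs (t.1 * j.1, j.2).1 * (r / 2) ^+ size (t.1 * j.1, j.2).2 =
    cabs t.1 * pnorm (r / 2) (dmono b t.2).
  by rewrite /pnorm mulr_sumr; apply: eq_bigr => s _; rewrite cabsM mulrA.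
rewrite mulrCA [leRHS]mulrCA ler_wpM2l ?cabs_ge0//.
apply: le_trans (pnorm_dmono _ bB (ltW r2)) _.
rewrite exprMn exprVn mulrAC mulrC ler_wpM2l// mulrC -mulrA ler_piMr ?exprn_ge0 ?(ltW r0)//.
by rewrite mulrC ler_pdivrMr ?exprn_gt0// mul1r -natrX ler_nat ltnW// ltn_expl.
Qed.

Lemma cabs_mono_eval l u r : 0 <= r -> small u r ->
  cabs (mono_eval l u) <= r ^+ size l.
Proof.
move=> r0 ur; elim: l => [|j l IH].
  by rewrite /mono_eval big_nil cabs1.
by rewrite mono_eval_cons cabsM exprS ler_pM ?cabs_ge0.
Qed.

(** The two bounds are proved together: adding a letter [j] makes the new remainder [u_j] times the
    old one plus [v_j] times the old increment. The radius doubles because [u + v] lies in the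
    polydisc of radius [2 * r]. *)
Lemma mono_taylor l u v (r e : R) : 0 <= r -> 0 <= e <= 1 ->
  small u r -> small v (e * r) ->
  cabs (mono_eval l (u + v) - mono_eval l u) <= e * (2 * r) ^+ size l /\
  cabs (mono_eval l (u + v) - mono_eval l u - mono_der l u v) <=
    e ^+ 2 * (2 * r) ^+ size l.
Proof.
move=> r0 /andP[e0 e1] ur ver.
have r20 : 0 <= 2 * r by rewrite mulr_ge0.
have uvr : small (u + v) (2 * r).
  apply: small_le (smallD ur ver).
  by rewrite mulrDl mul1r lerD2l ler_piMl.
elim: l => [|j l [IH1 IH2]] /=.
  by rewrite /mono_eval !big_nil subrr subr0 cabs0 !mulr_ge0.
rewrite !mono_eval_cons.
set E' := mono_eval l (u + v); set E := mono_eval l u in IH1 IH2 *.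
set D := mono_der l u v in IH2 *; set q := (2 * r) ^+ size l.
have q0 : 0 <= q by rewrite exprn_ge0.
have E'q : cabs E' <= q by exact: cabs_mono_eval.
have vj := ver j; have uj := ur j.
split.
  have -> : (u + v) 0 j * E' - u 0 j * E = u 0 j * (E' - E) + v 0 j * E'.
    by rewrite mxE; ring.
  rewrite [(2 * r) ^+ _]exprS -/q.
apply: le_trans (cabsD _ _) _; rewrite !cabsM.
  have -> : e * (2 * r * q) = r * (e * q) + e * r * q by ring.
  by rewrite lerD// ler_pM ?cabs_ge0.
have -> : (u + v) 0 j * E' - u 0 j * E - (v 0 j * E + u 0 j * D) =
    u 0 j * (E' - E - D) + v 0 j * (E' - E).
  by rewrite mxE; ring.
rewrite [(2 * r) ^+ _]exprS -/q.
apply: le_trans (cabsD _ _) _; rewrite !cabsM.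
have -> : e ^+ 2 * (2 * r * q) = r * (e ^+ 2 * q) + e * r * (e * q) by ring.
by rewrite lerD// ler_pM ?cabs_ge0.
Qed.

Lemma poly_taylor P u v (r e : R) : 0 <= r -> 0 <= e <= 1 ->
  small u r -> small v (e * r) ->
  cabs (peval P (u + v) - peval P u - pder P u v) <= e ^+ 2 * pnorm (2 * r) P.
Proof.
move=> r0 e01 ur ver.
rewrite /peval /pder -!sumrB /pnorm mulr_sumr.
apply: le_trans (cabs_sum _ _ _) _; apply: ler_sum => t _.
rewrite -!mulrBr cabsM mulrCA ler_wpM2l ?cabs_ge0//.
by have [_] := mono_taylor t.2 r0 e01 ur ver.
Qed.

End FormalPolynomials.

(** * Limits of complex families along a filter *)

Section PolynomialLimits.
Variables (R : realType) (n : nat) (T : Type) (Fil : set_system T).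
Context {PF : ProperFilter Fil}.
Implicit Types (x y : T -> Cx R) (l : Cx R).

Definition clim x l :=
  forall e : R, 0 < e -> \forall B \near Fil, cabs (x B - l) < e.

Lemma climD x y l l' : clim x l -> clim y l' ->
  clim (fun B => x B + y B) (l + l').
Proof.
move=> xl yl e e0; have e2 : 0 < e / 2 by rewrite divr_gt0.
near=> B.
have h : cabs (x B - l) < e / 2 by near: B; exact: xl.
have h' : cabs (y B - l') < e / 2 by near: B; exact: yl.
have -> : x B + y B - (l + l') = (x B - l) + (y B - l') by ring.
apply: le_lt_trans (cabsD _ _) _; lra.
Unshelve. all: by end_near. Qed.

Lemma climZ (c : Cx R) x l : clim x l -> clim (fun B => c * x B) (c * l).
Proof.
move=> xl e e0; have c1 : 0 < cabs c + 1 by rewrite ltr_wpDl ?cabs_ge0.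
near=> B.
have h : cabs (x B - l) < e / (cabs c + 1).
  by near: B; apply: xl; rewrite divr_gt0.
rewrite -mulrBr cabsM; move: h; rewrite ltr_pdivlMr//.
by apply: le_lt_trans; rewrite mulrC ler_wpM2l ?cabs_ge0// lerDl.
Unshelve. all: by end_near. Qed.

Lemma climB x y l l' : clim x l -> clim y l' ->
  clim (fun B => x B - y B) (l - l').
Proof.
move=> xl yl; have := climD xl (climZ (-1) yl).
by congr clim; [apply/funext => B|]; rewrite mulN1r.
Qed.

Lemma clim_le x l (K : R) : clim x l -> (forall B, cabs (x B) <= K) ->
  cabs l <= K.
Proof.
move=> xl xK; apply/ler_addgt0Pr => e e0.
have [B Bl] := filter_ex (xl e e0).
have := cabsB (x B) (x B - l); have := xK B.
rewrite subKr; lra.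
Qed.

Lemma clim_unique x l l' : clim x l -> clim x l' -> l = l'.
Proof.
move=> xl xl'; have := climB xl xl' => d.
apply/eqP; rewrite -subr_eq0 -cabs_eq0 eq_le cabs_ge0 andbT.
by apply: clim_le d _ => B; rewrite subrr cabs0.
Qed.

Lemma clim_complete x :
  (forall e : R, 0 < e -> exists l, \forall B \near Fil, cabs (x B - l) < e) ->
  exists l, clim x l.
Proof.
move=> H.
have cv (P : Cx R -> R) : (forall z w, `|P z - P w| <= cabs (z - w)) ->
    exists a : R, (P \o x) @ Fil --> a.
  move=> Plip; apply/cvg_ex/cauchy_cvgP/cauchy_exP => e e0.
  have [l Hl] := H e e0; exists (P l).
  change (\forall B \near Fil, ball (P l) e (P (x B))); near=> B.
  rewrite -ball_normE /=; apply: le_lt_trans (Plip _ _) _.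
  by rewrite cabs_distC; near: B.
have [a ha] : exists a : R, ((@Re R) \o x) @ Fil --> a.
  by apply: cv => z w; rewrite -ReN -ReD normr_Re_cabs.
have [b hb] : exists b : R, ((@Im R) \o x) @ Fil --> b.
  by apply: cv => z w; rewrite -ImN -ImD normr_Im_cabs.
exists (Complex a b) => e e0; have e2 : 0 < e / 2 by rewrite divr_gt0.
near=> B; apply: le_lt_trans (cabs_le_ReIm _) _.
rewrite ReD ReN ImD ImN /=.
have h1 : `|a - Re (x B)| < e / 2.
  by near: B; move/cvgrPdist_lt : ha; apply.
have h2 : `|b - Im (x B)| < e / 2.
  by near: B; move/cvgrPdist_lt : hb; apply.
by rewrite distrC [X in _ + X]distrC; lra.
Unshelve. all: by end_near. Qed.

End PolynomialLimits.

(** * Local limits of polynomials and their derivatives *)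

Section LocalLimits.
Variables (R : realType) (n : nat) (T : Type) (Fil : set_system T).
Context {PF : ProperFilter Fil}.
Implicit Types (u v w z b : 'rV[Cx R]_n) (f : 'rV[Cx R]_n -> Cx R).

(* The class of limits of norm-bounded families of polynomials is stable under
   differentiation; no Cauchy estimate is needed for that, because the second
   order remainders are bounded uniformly along the family. *)
Definition poly_lim z f := exists (p : T -> seq (Cx R * seq 'I_n)) (r d M : R),
  [/\ 0 < r, 0 < d, forall B, pnorm r (p B) <= M
    & forall u, small u d -> clim Fil (fun B => peval (p B) u) (f (z + u))].

(** The point is that the derivatives of the approximating polynomials converge. For a fixed step
    [h] their difference quotients converge, being built from values, and they differ from the
    derivatives by [O(h)] uniformly along the family; completeness then yields [Df]. Linearity and
    the remainder bound pass to the limit. *)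
Lemma poly_lim_expansion z f : poly_lim z f ->
  exists (Df : 'rV[Cx R]_n -> 'rV[Cx R]_n -> Cx R) (d K : R),
  [/\ 0 < d, 0 <= K,
      forall u v v' (c : Cx R), small u d ->
        Df u (c *: v + v') = c * Df u v + Df u v',
      forall u v (h : R), small u d -> 0 <= h <= d -> small v h ->
        cabs (f (z + u + v) - f (z + u) - Df u v) <= K * h ^+ 2
    & forall b, poly_lim z (fun w => Df (w - z) b)].
Proof.
move=> [p [r [d0 [M [r0 d00 pM pf]]]]].
(* The Taylor bound on the polydisc of radius [rho] involves the norm at [2 * rho], which has to be
   [r]. *)
pose rho := r / 2; have rho0 : 0 < rho by rewrite divr_gt0.
have rhor : 2 * rho = r by rewrite /rho mulrC divfK.
pose d := Num.min (d0 / 2) rho.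
have dd0 : d <= d0 / 2 by rewrite ge_min lexx.
have drho : d <= rho by rewrite ge_min lexx orbT.
have d_gt0 : 0 < d by rewrite lt_min rho0 divr_gt0.
have [B0 _] := filter_ex (filterT : Fil setT).
have M0 : 0 <= M by apply: le_trans (pM B0); rewrite pnorm_ge0 ?(ltW r0).
pose K := M / rho ^+ 2.
have K0 : 0 <= K by rewrite divr_ge0 ?exprn_ge0 ?(ltW rho0).
have rem u v (h : R) B : small u d -> 0 <= h <= d -> small v h ->
    cabs (peval (p B) (u + v) - peval (p B) u - pder (p B) u v) <= K * h ^+ 2.
  move=> ud /andP[h0 hd] vh.
  have := @poly_taylor _ _ (p B) u v rho (h / rho) (ltW rho0).
  rewrite divr_ge0 ?(ltW rho0)//= ler_pdivrMr// mul1r divfK ?gt_eqF// => H.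
  apply: le_trans (H (le_trans hd drho) (small_le drho ud) vh) _.
  rewrite rhor expr_div_n /K [leRHS]mulrC [leRHS]mulrA [leRHS]mulrAC.
  by rewrite ler_wpM2l ?divr_ge0 ?sqr_ge0.
have limE u v : small u d -> exists l, clim Fil (fun B => pder (p B) u v) l.
  move=> ud; have [V [V0 vV]] := small_exists v.
  apply: clim_complete => e e0.
  have K1 : 0 < K + 1 by rewrite ltr_wpDl.
  (* The first bound keeps [u + h v] in range; the second makes the remainder [K (h V)^2] at most
     [h * (e / 2)]. *)
  pose h := Num.min (d / V) (e / (2 * ((K + 1) * V ^+ 2))).
  have h0 : 0 < h by rewrite lt_min !divr_gt0// !mulr_gt0// exprn_gt0.
  have hV : 0 <= h * V <= d.
    by rewrite mulr_ge0 ?(ltW h0) ?(ltW V0)//= -ler_pdivlMr// ge_min lexx.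
  have he : h * ((K + 1) * V ^+ 2) <= e / 2.
    rewrite -ler_pdivlMr ?mulr_gt0 ?exprn_gt0// -mulrA -invfM.
    by rewrite ge_min lexx orbT.
  have hc : cabs (h%:C : Cx R) = h by rewrite cabs_real gtr0_norm.
  have hvs : small ((h%:C : Cx R) *: v) (h * V) by rewrite -{2}hc; exact: smallZ.
  have h_neq0 : (h%:C : Cx R) != 0 by rewrite -cabs_gt0 hc.
  exists ((h%:C)^-1 * (f (z + (u + h%:C *: v)) - f (z + u))).
  have cu : clim Fil (fun B => peval (p B) (u + h%:C *: v) - peval (p B) u)
      (f (z + (u + h%:C *: v)) - f (z + u)).
    apply: climB; apply: pf.
      apply: small_le (smallD ud hvs).
      by have /andP[_] := hV; lra.
    by apply: small_le ud; lra.
  have q0 : 0 < h * (e / 2) by rewrite mulr_gt0 ?divr_gt0.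
  near=> B.
  have near1 : cabs (peval (p B) (u + h%:C *: v) - peval (p B) u -
      (f (z + (u + h%:C *: v)) - f (z + u))) < h * (e / 2) by near: B; exact: cu.
  have := rem u _ _ B ud hV hvs; rewrite pderZ => rem1.
  set P := peval (p B) _ - _ in near1 rem1; set G := f _ - _ in near1 *.
  rewrite -(ltr_pM2l h0) -[X in X * cabs _]hc -cabsM.
  have -> : h%:C * (pder (p B) u v - h%:C^-1 * G) =
      (P - G) - (P - h%:C * pder (p B) u v).
    by rewrite mulrBr mulrA mulfV// mul1r; ring.
  apply: le_lt_trans (cabsB _ _) _.
  have : K * (h * V) ^+ 2 <= h * (e / 2).
    have -> : K * (h * V) ^+ 2 = h * (h * (K * V ^+ 2)) by ring.
    rewrite ler_wpM2l ?(ltW h0)// (le_trans _ he)// ler_wpM2l ?(ltW h0)//.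
    by rewrite ler_wpM2r ?sqr_ge0// lerDl.
  have -> : h * e = h * (e / 2) + h * (e / 2) by field.
  by move=> ?; rewrite ltr_leD// (le_trans rem1).
have /choice[Df HDf] : forall uv : 'rV[Cx R]_n * 'rV[Cx R]_n, exists l,
    small uv.1 d -> clim Fil (fun B => pder (p B) uv.1 uv.2) l.
  (* Outside the polydisc [Df] takes the default value 0. *)
  move=> [u v] /=; have [ud|nud] := pselect (small u d); last by exists 0.
  by have [l Hl] := limE u v ud; exists l.
have DfE u v : small u d -> clim Fil (fun B => pder (p B) u v) (Df (u, v)).
  exact: HDf (u, v).
exists (fun u v => Df (u, v)), d, K; split=> //.
- move=> u v v' c ud; apply: clim_unique (DfE u _ ud) _.
  rewrite (_ : (fun B => _) =
    (fun B => c * pder (p B) u v + pder (p B) u v')); last first.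
    by apply/funext => B; rewrite pderD pderZ.
  by apply: climD; [apply: climZ|]; exact: DfE.
- move=> u v h ud hd vh; have /andP[h0 hd'] := hd.
  have ud0 : small u d0 by apply: small_le ud; lra.
  have uvd0 : small (u + v) d0 by apply: small_le (smallD ud vh); lra.
  have cl : clim Fil
      (fun B => peval (p B) (u + v) - peval (p B) u - pder (p B) u v)
      (f (z + (u + v)) - f (z + u) - Df (u, v)).
    by apply: climB (DfE _ _ ud); apply: climB; exact: pf.
  by rewrite -(addrA z u v); apply: clim_le cl (fun B => rem u v h B ud hd vh).
- move=> b; have [B [B_gt0 bB]] := small_exists b.
  exists (fun i => dpoly b (p i)), (r / 2), d, (B / (r / 2) * M); split=> //.
    move=> i; apply: le_trans (pnorm_dpoly _ bB (ltW B_gt0) r0) _.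
    by apply: ler_wpM2l => //; apply: divr_ge0; exact: ltW.
  move=> u ud; rewrite [z + u]addrC addrK.
  by under eq_fun do rewrite peval_dpoly; exact: DfE.
Unshelve. all: by end_near. Qed.

(** Since [dirD] is built from partial derivatives, these are identified with [Df u (delta_mx 0 j)]
    through the expansion, and linearity of [Df u] reassembles [Df u b]. The identity holds on a
    whole polydisc, so [dirD b f] is again a limit of the same kind and the argument iterates. *)
Lemma poly_lim_dirD z f b : poly_lim z f ->
  poly_lim z (dirD b f) /\
  exists K d : R, 0 < d /\ forall t : Cx R, cabs t < d ->
    cabs (f (z + t *: b) - f z - t * dirD b f z) <= K * cabs t ^+ 2.
Proof.
move=> /poly_lim_expansion[Df [d [K [d0 K0 lin exp lim]]]].
have Df0 u : small u d -> Df u 0 = 0.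
  move=> ud; have := lin u 0 0 (-1) ud.
  by rewrite scaler0 addr0 mulN1r addNr.
have D u : small u d -> dirD b f (z + u) = Df u b.
  move=> ud.
  have De j : 'D_(delta_mx 0 j) f (z + u) = Df u (delta_mx 0 j).
    suff : is_derive (z + u) (delta_mx 0 j) f (Df u (delta_mx 0 j)) by case.
    apply: (@is_derive_quad _ _ _ _ _ _ _ (K%:C : Cx R) (d%:C : Cx R)).
    - by rewrite ler0c.
    - by rewrite ltcR.
    - move=> h; rewrite !norm_cabs ltcR => hd.
      have hs : small (h *: delta_mx 0 j) (cabs h).
        move=> i; rewrite !mxE cabsM eqxx/= ler_piMr ?cabs_ge0//.
        by case: (_ == _); rewrite ?cabs1 ?cabs0 ?ler01.
      have hd' : 0 <= cabs h <= d by rewrite cabs_ge0 ltW.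
      have := exp u _ _ ud hd' hs.
      have -> : Df u (h *: delta_mx 0 j) = h * Df u (delta_mx 0 j).
        by rewrite -[h *: _]addr0 lin// Df0// addr0.
      by rewrite -rmorphXn -rmorphM lecR (addrC (h *: _)).
  rewrite /dirD (eq_bigr (fun j => b 0 j * Df u (delta_mx 0 j))); last first.
    by move=> j _; rewrite De mulrC.
  rewrite [in RHS](row_sum_delta b).
  have lins (I : Type) (s : seq I) (c : I -> Cx R) (V : I -> 'rV[Cx R]_n) :
      Df u (\sum_(i <- s) c i *: V i) = \sum_(i <- s) c i * Df u (V i).
    elim: s => [|i s IH]; first by rewrite !big_nil Df0.
    by rewrite !big_cons lin// IH.
  by rewrite lins.
split.
  have [p [r [d' [M [r0 d'0 pM pf]]]]] := lim b.
  exists p, r, (Num.min d' d), M; split=> //; first by rewrite lt_min d'0.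
  move=> u ud; rewrite D; last by apply: small_le ud; rewrite ge_min lexx orbT.
  have := pf u; rewrite [z + u]addrC addrK; apply.
  by apply: small_le ud; rewrite ge_min lexx.
have [V [V0 bV]] := small_exists b.
exists (K * V ^+ 2), (d / V); split=> [|t]; first by rewrite divr_gt0.
rewrite ltr_pdivlMr// => td.
have s0 : small (0 : 'rV[Cx R]_n) d by apply: small0; rewrite ltW.
have := exp 0 (t *: b) (cabs t * V) s0.
rewrite addr0 mulr_ge0 ?cabs_ge0 ?(ltW V0)//= (ltW td) => /(_ isT (smallZ t bV)).
rewrite -[t *: b]addr0 lin// Df0// !addr0 -(D 0 s0) addr0.
by rewrite exprMn mulrCA [_ * cabs t ^+ 2]mulrC mulrA.
Qed.

End LocalLimits.

(** * From power series to limits of polynomials *)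

Section AnalyticFunctions.
Variables (R : realType).

(** The terms of each sign form a subsum, to which the bound applies. *)
Lemma sum_norm_le (I : choiceType) (y : I -> R) (c : R) (A : {fset I}) :
  (forall B : {fset I}, (B `<=` A)%fset -> `|\sum_(i <- B) y i| <= c) ->
  \sum_(i <- A) `|y i| <= 2 * c.
Proof.
move=> H; rewrite (big_fsetID _ (fun i => 0 <= y i))/=.
set P := [fset x in A | 0 <= y x]%fset; set N := [fset x in A | ~~ (0 <= y x)]%fset.
have -> : \sum_(i <- P) `|y i| = \sum_(i <- P) y i.
  by apply: eq_big_seq => i; rewrite !inE => /andP[_ /ger0_norm].
have -> : \sum_(i <- N) `|y i| = - \sum_(i <- N) y i.
  rewrite -sumrN; apply: eq_big_seq => i; rewrite !inE -ltNge => /andP[_ yi].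
  by rewrite ltr0_norm.
have PA : (P `<=` A)%fset by apply/fsubsetP => i; rewrite !inE => /andP[].
have NA : (N `<=` A)%fset by apply/fsubsetP => i; rewrite !inE => /andP[].
have := ler_norm (\sum_(i <- P) y i); have := H _ PA.
have := ler_norm (- \sum_(i <- N) y i); rewrite normrN; have := H _ NA.
lra.
Qed.

Lemma sum_cabs_le (I : choiceType) (x : I -> Cx R) (c : R) (A : {fset I}) :
  (forall B : {fset I}, (B `<=` A)%fset -> cabs (\sum_(i <- B) x i) <= c) ->
  \sum_(i <- A) cabs (x i) <= 4 * c.
Proof.
move=> H.
have ReS (B : {fset I}) : Re (\sum_(i <- B) x i) = \sum_(i <- B) Re (x i).
  by apply: (big_morph _ _ _) => // z w; rewrite ReD.
have ImS (B : {fset I}) : Im (\sum_(i <- B) x i) = \sum_(i <- B) Im (x i).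
  by apply: (big_morph _ _ _) => // z w; rewrite ImD.
apply: (@le_trans _ _ (\sum_(i <- A) (`|Re (x i)| + `|Im (x i)|))).
  by apply: ler_sum => i _; exact: cabs_le_ReIm.
have h1 := @sum_norm_le _ (fun i => Re (x i)) c A.
have h2 := @sum_norm_le _ (fun i => Im (x i)) c A.
rewrite big_split/= (_ : 4 * c = 2 * c + 2 * c); last by ring.
apply: lerD; [apply: h1|apply: h2] => B BA.
  by rewrite -ReS (le_trans (normr_Re_cabs _))// H.
by rewrite -ImS (le_trans (normr_Im_cabs _))// H.
Qed.

(** Past some finite set [A] all sums are within 1 of [l], so a finite sum over indices outside [A]
    is a difference of two such sums and has modulus at most 2; passing to the sum of the moduli
    costs a factor 4. *)
Lemma totally_summable_bounded (I : choiceType) (x : I -> Cx R) (l : Cx R) :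
  clim summability.totally (fun B : {fset I} => \sum_(i <- B) x i) l ->
  exists M : R, forall B : {fset I}, \sum_(i <- B) cabs (x i) <= M.
Proof.
move=> /(_ _ (@ltr01 R)) [A _ HA].
exists (\sum_(i <- A) cabs (x i) + 4 * 2) => B.
rewrite (big_fsetID _ (mem A))/= lerD//.
  have -> : [fset i in B | i \in A]%fset = (B `&` A)%fset.
    by apply/fsetP => i; rewrite !inE.
  rewrite [leRHS](big_fsetID _ (mem B))/= ler_wpDr//.
    by apply: sumr_ge0 => i _; exact: cabs_ge0.
  have -> // : [fset i in A | i \in B]%fset = (B `&` A)%fset.
  by apply/fsetP => i; rewrite !inE andbC.
apply: sum_cabs_le => D /fsubsetP DB.
have DA : [disjoint A & D]%fset.
  by rewrite fdisjoint_sym; apply/fdisjointP => i /DB; rewrite !inE => /andP[].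
have : cabs (\sum_(i <- (A `|` D)%fset) x i - l) < 1.
  by apply: HA; rewrite /= fsubsetUl.
have : cabs (\sum_(i <- A) x i - l) < 1 by apply: HA => /=.
have -> : \sum_(i <- (A `|` D)%fset) x i = \sum_(i <- A) x i + \sum_(i <- D) x i.
  rewrite (big_fsetID _ (mem A))/=.
  have -> : [fset i in (A `|` D)%fset | i \in A]%fset = A.
    by apply/fsetP => i; rewrite !inE; case: (i \in A); rewrite ?andbF.
  have -> // : [fset i in (A `|` D)%fset | i \notin A]%fset = D.
  apply/fsetP => i; rewrite !inE; case iA : (i \in A) => /=; last by rewrite andbT.
  by apply/esym/negbTE; move/fdisjointP : DA => /(_ i iA).
set S := \sum_(i <- A) _; set S' := \sum_(i <- D) _ => h1 h2.
have -> : S' = (S + S' - l) - (S - l) by ring.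
by apply: le_trans (cabsB _ _) _; lra.
Qed.

Variable n : nat.
Implicit Types (u w z b : 'rV[Cx R]_n).

Lemma near_small z (P : 'rV[Cx R]_n -> Prop) : (\forall w \near z, P w) ->
  exists d : R, 0 < d /\ forall u, small u d -> P (z + u).
Proof.
(* The radius [e] is itself an element of [Cx R], real because positive; its half makes room for the
   non-strict [small]. *)
move=> /nbhs_ballP[e /= e0 He].
move: e0 He; rewrite ltcE/= => /andP[/eqP Ime Ree] He.
exists (Re e / 2); split=> [|u us]; first by rewrite divr_gt0.
apply: He; split=> [|i j]; first by rewrite ltcE/= Ime eqxx.
rewrite -ball_normE /= !ord1 mxE opprD addNKr normrN norm_cabs ltcE/= Ime eqxx/=.
by apply: le_lt_trans (us j) _; lra.
Qed.

Definition expand (a : {ffun 'I_n -> nat}) : seq 'I_n :=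
  flatten [seq nseq (a j) j | j <- index_enum 'I_n].

Lemma prod_expand (K : comNzRingType) (h : 'I_n -> K) (a : {ffun 'I_n -> nat}) :
  \prod_(j <- expand a) h j = \prod_j h j ^+ a j.
Proof.
rewrite /expand big_flatten big_map; apply: eq_bigr => j _.
by rewrite big_nseq; elim: (a j) => [|k IH]; rewrite ?expr0// exprS -IH.
Qed.

(** The polynomials are the finite partial sums. Their norm at radius [d] is the sum of the moduli
    of their terms at the point with all coordinates [d], bounded because the series converges
    unconditionally there. *)
Lemma analytic_poly_lim (D : set 'rV[Cx R]_n) F z : analytic_in D F -> D z ->
  poly_lim (summability.totally : set_system {fset {ffun 'I_n -> nat}}) z F.
Proof.
have PF := @summability.totally_filter {ffun 'I_n -> nat}.
move=> anF /anF [c /near_small[d [d0 Hd]]].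
have ps u (B : {fset {ffun 'I_n -> nat}}) : power_series c z (z + u) B =
    \sum_(a <- B) c a * mono_eval (expand a) u.
  rewrite /power_series /summability.partial_sum [RHS]big_seq_fsetE/=.
  apply: eq_bigr => a _; rewrite /mono_eval prod_expand; congr (_ * _).
  by apply: eq_bigr => j _; rewrite mxE addrAC subrr add0r.
have lim u : small u d -> clim summability.totally
    (fun B => \sum_(a <- B) c a * mono_eval (expand a) u) (F (z + u)).
  move=> /Hd H e e0.
  move/cvgrPdist_lt : H => /(_ e%:C); rewrite ltcR => /(_ e0).
  apply: filterS => B; rewrite norm_cabs ltcR ps.
  by rewrite -cabs_distC.
pose u0 : 'rV[Cx R]_n := const_mx d%:C.
have u0d : small u0 d by move=> j; rewrite mxE cabs_real gtr0_norm.
have [M HM] := totally_summable_bounded (lim u0 u0d).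
exists (fun B => [seq (c a, expand a) | a <- enum_fset B]), d, d, M; split=> //.
  move=> B; apply: le_trans (HM B); rewrite /pnorm big_map le_eqVlt.
  apply/orP; left; apply/eqP; apply: eq_bigr => a _ /=.
  rewrite cabsM; congr (_ * _); elim: (expand a) => [|j l IH] /=.
    by rewrite /mono_eval big_nil cabs1.
  by rewrite mono_eval_cons cabsM exprS IH mxE cabs_real gtr0_norm.
move=> u ud; have := lim u ud; congr clim; apply/funext => B.
by rewrite /peval big_map.
Qed.

Lemma analytic_dirDn (D : set 'rV[Cx R]_n) F z b k : analytic_in D F -> D z ->
  exists K d : R, 0 < d /\ forall t : Cx R, cabs t < d ->
    cabs (dirDn b k F (z + t *: b) - dirDn b k F z - t * dirDn b k.+1 F z) <=
      K * cabs t ^+ 2.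
Proof.
move=> anF Dz.
have PF := @summability.totally_filter {ffun 'I_n -> nat}.
suff : poly_lim (summability.totally : set_system {fset {ffun 'I_n -> nat}}) z
    (dirDn b k F) by move=> /(poly_lim_dirD b)[].
elim: k => [|k /(poly_lim_dirD b)[]//].
exact: analytic_poly_lim anF Dz.
Qed.

End AnalyticFunctions.

(** * Bounded index *)

Section EuclideanNorm.
Variables (R : realType) (n : nat).
Implicit Types (z w b : 'rV[Cx R]_n).

Lemma enorm_ge0 z : 0 <= enorm z.
Proof. exact: sqrtr_ge0. Qed.

Lemma sqr_enorm z : enorm z ^+ 2 = \sum_j cabs (z 0 j) ^+ 2.
Proof. by rewrite sqr_sqrtr// sumr_ge0// => j _; exact: sqr_ge0. Qed.

Lemma enormZ (t : Cx R) z : enorm (t *: z) = cabs t * enorm z.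
Proof.
apply/eqP; rewrite -(@eqrXn2 _ 2) ?mulr_ge0 ?enorm_ge0 ?cabs_ge0//.
rewrite exprMn !sqr_enorm mulr_sumr; apply/eqP/eq_bigr => j _.
by rewrite mxE cabsM exprMn.
Qed.

Lemma enorm_eq0 z : enorm z = 0 -> forall j, cabs (z 0 j) = 0.
Proof.
move=> z0 j; apply/eqP; rewrite -sqrf_eq0 eq_le sqr_ge0 andbT.
have : \sum_j cabs (z 0 j) ^+ 2 = 0 by rewrite -sqr_enorm z0 expr0n.
rewrite (bigD1 j)//= => <-; rewrite lerDl sumr_ge0// => i _; exact: sqr_ge0.
Qed.

(** Termwise arithmetic-geometric inequality, with weights that give both halves of the sum the
    value [enorm z * enorm w / 2]. *)
Lemma enorm_cauchy_schwarz z w :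
  \sum_j cabs (z 0 j) * cabs (w 0 j) <= enorm z * enorm w.
Proof.
have [z0|z0] := eqVneq (enorm z) 0.
  by rewrite z0 mul0r big1// => j _; rewrite enorm_eq0// mul0r.
have [w0|w0] := eqVneq (enorm w) 0.
  by rewrite w0 mulr0 big1// => j _; rewrite [X in _ * X]enorm_eq0// mulr0.
have Z0 : 0 < enorm z by rewrite lt_def z0 enorm_ge0.
have W0 : 0 < enorm w by rewrite lt_def w0 enorm_ge0.
have -> : enorm z * enorm w = \sum_j (enorm w / enorm z * cabs (z 0 j) ^+ 2 +
    enorm z / enorm w * cabs (w 0 j) ^+ 2) / 2.
  rewrite -mulr_suml big_split/= -!mulr_sumr -!sqr_enorm.
  by field; rewrite z0 w0.
apply: ler_sum => j _; rewrite -subr_ge0.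
set x := cabs _; set y := cabs _; set a := enorm z; set b := enorm w.
have -> : (b / a * x ^+ 2 + a / b * y ^+ 2) / 2 - x * y =
    (b * x - a * y) ^+ 2 / (2 * a * b).
  by field; rewrite z0 w0.
by rewrite divr_ge0 ?sqr_ge0// !mulr_ge0// enorm_ge0.
Qed.

Lemma enormD z w : enorm (z + w) <= enorm z + enorm w.
Proof.
rewrite -(@ler_pXn2r _ 2) ?nnegrE ?addr_ge0 ?enorm_ge0//.
rewrite sqrrD !sqr_enorm -mulr_natl.
apply: (@le_trans _ _ (\sum_j (cabs (z 0 j) + cabs (w 0 j)) ^+ 2)).
  apply: ler_sum => j _; rewrite mxE lerXn2r ?nnegrE ?addr_ge0 ?cabs_ge0//.
  exact: cabsD.
rewrite (eq_bigr (fun j => cabs (z 0 j) ^+ 2 + 2 * (cabs (z 0 j) * cabs (w 0 j)) +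
    cabs (w 0 j) ^+ 2)); last by move=> j _; rewrite sqrrD mulr_natl.
rewrite !big_split/= lerD2r lerD2l -mulr_sumr ler_wpM2l//.
exact: enorm_cauchy_schwarz.
Qed.

End EuclideanNorm.

Section DirectionalIndex.
Variables (R : realType) (n : nat) (b : 'rV[Cx R]_n).
Implicit Types (z : 'rV[Cx R]_n) (L : 'rV[Cx R]_n -> R).
Implicit Types (F : 'rV[Cx R]_n -> Cx R).

(** The growth condition says that [beta |b| / L z] is less than [1 - |z|]. *)
Lemma classQ_ball (beta : R) L z (t : Cx R) : 0 <= beta -> classQ b beta L ->
  unit_ball R n z -> cabs t <= beta / L z -> unit_ball R n (z + t *: b).
Proof.
move=> beta0 [_ Lpos Lgt _] zB tle.
have L0 := Lpos _ zB; have := Lgt _ zB.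
have z1 : 0 < 1 - enorm z by rewrite subr_gt0.
rewrite ltr_pdivrMr// => bL.
rewrite /unit_ball/=; apply: le_lt_trans (enormD _ _) _.
rewrite -ltrBrDl enormZ; apply: (@le_lt_trans _ _ (beta / L z * enorm b)).
  by rewrite ler_wpM2r ?enorm_ge0.
by rewrite mulrAC ltr_pdivrMr// mulrC [in ltRHS]mulrC mulrC.
Qed.

Lemma classQ_ratio (beta : R) L : 0 <= beta -> classQ b beta L ->
  exists lam : R, 1 <= lam /\ forall z (t : Cx R), unit_ball R n z ->
    cabs t <= beta / L z -> L (z + t *: b) <= lam * L z.
Proof.
move=> beta0 [_ Lpos _ /(_ beta)]; rewrite beta0 lexx => /(_ isT)[_ _ lt2].
(* The maximum with 1 makes the powers of [lam] nondecreasing in the exponent. *)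
exists (Num.max 1 (fine (lambda2 b L beta))); split; first by rewrite le_max lexx.
move=> z t zB tle; have L0 := Lpos _ zB.
rewrite -ler_pdivrMr// le_max; apply/orP; right.
have : ((L (z + t *: b) / L z)%:E <= lambda2 b L beta)%E.
  apply: ereal_sup_ubound; exists z, 0, t; split=> //.
  - by rewrite /slice/= scale0r addr0.
  - by rewrite subr0 scale0r addr0.
  - by rewrite scale0r addr0.
by case: (lambda2 b L beta) lt2 => [x| |]//= _; rewrite lee_fin.
Qed.

(** Chain rule: each derivative in [s] brings out a factor [c]. With [c = 1 / L z] these are the
    successive derivatives of the rescaled slice. *)
Lemma slice_quad_diff (D : set 'rV[Cx R]_n) F z k (c x : Cx R) :
  analytic_in D F -> D (z + (x * c) *: b) ->
  quad_diff (fun s => c ^+ k * dirDn b k F (z + (s * c) *: b)) x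
    (c ^+ k.+1 * dirDn b k.+1 F (z + (x * c) *: b)).
Proof.
move=> anF Dx; have [K [d [d0 H]]] := analytic_dirDn b k anF Dx.
have c1 : 0 < cabs c + 1 by rewrite ltr_wpDl ?cabs_ge0.
exists (cabs c ^+ k * (K * cabs c ^+ 2)), (d / (cabs c + 1)).
split=> [|s]; first by rewrite divr_gt0.
rewrite ltr_pdivlMr// => sd.
rewrite !(hornerD, hornerM, hornerC, hornerX) mulrDl scalerDl addrA.
set w := z + (x * c) *: b; set A := dirDn _ _ _ _; set B := dirDn _ _ _ _.
set E := dirDn _ _ _ _.
have -> : c ^+ k * A - (c ^+ k * B + c ^+ k.+1 * E * s) =
    c ^+ k * (A - B - s * c * E) by rewrite exprS; ring.
rewrite cabsM cabsX -[leRHS]mulrA ler_wpM2l ?exprn_ge0 ?cabs_ge0//.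
have -> : K * cabs c ^+ 2 * cabs s ^+ 2 = K * cabs (s * c) ^+ 2.
  by rewrite cabsM exprMn; ring.
apply: H; rewrite cabsM (le_lt_trans _ sd)// ler_wpM2l ?cabs_ge0// lerDl.
exact: ler01.
Qed.

Lemma exprn_unbounded (r K : R) : 1 < r -> exists N, K <= r ^+ N.
Proof.
move=> r1; have bern k : 1 + k%:R * (r - 1) <= r ^+ k.
  elim: k => [|k IH]; first by rewrite mul0r addr0 expr0.
  rewrite exprS -natr1; have k0 : 0 <= k%:R :> R by [].
  apply: le_trans (ler_wpM2l (ltW (lt_trans ltr01 r1)) IH).
  rewrite -subr_ge0 (_ : _ - _ = k%:R * (r - 1) ^+ 2); last by ring.
  by rewrite mulr_ge0 ?sqr_ge0.
have r10 : 0 < r - 1 by rewrite subr_gt0.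
exists (Num.bound (`|K| / (r - 1))); apply: le_trans (bern _).
have : 0 <= `|K| / (r - 1) by apply: divr_ge0 => //; exact: ltW.
by move=> /archi_boundP; rewrite ltr_pdivrMr//; have := ler_norm K; lra.
Qed.

Definition weighted_deriv L F k z := (L z ^+ k)^-1 * cabs (dirDn b k F z).

Lemma weighted_derivE L F k z : 0 < L z ->
  cabs (((L z ^+ k)^-1)%:C * dirDn b k F z) = weighted_deriv L F k z.
Proof.
by move=> L0; rewrite cabsM cabs_real ger0_norm// invr_ge0 exprn_ge0 ?ltW.
Qed.

Lemma weighted_deriv_ge0 L F k z : 0 < L z -> 0 <= weighted_deriv L F k z.
Proof. by move=> L0; rewrite mulr_ge0 ?cabs_ge0 ?invr_ge0 ?exprn_ge0 ?ltW. Qed.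

(** The factors [1 / k!] on the right are at most 1; the factorial on the left becomes the
    constant. *)
Lemma bounded_index_deriv_bound L F z p : 0 < L z ->
  (p.+1`!%:R)^-1 * weighted_deriv L F p.+1 z <=
    \big[Num.max/0]_(k < p.+1) ((k`!%:R)^-1 * weighted_deriv L F k z) ->
  weighted_deriv L F p.+1 z <=
    p.+1`!%:R * \big[Num.max/0]_(k < p.+1) weighted_deriv L F k z.
Proof.
move=> L0; rewrite ler_pdivrMl ?ltr0n ?fact_gt0// => /le_trans; apply.
rewrite ler_wpM2l//; apply: bigmax_le => [|k _]; first exact: bigmax_ge_id.
apply: le_trans (le_bigmax _ (fun k : 'I_p.+1 => weighted_deriv L F k z) k).
rewrite ler_piMl ?weighted_deriv_ge0//.
by rewrite invf_le1 ?ltr0n ?fact_gt0// ler1n fact_gt0.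
Qed.

Lemma deriv_bound_taylor (beta : R) L F p (C : R) : 1 < beta ->
  classQ b beta L -> analytic_in (unit_ball R n) F -> 0 < C ->
  (forall z, unit_ball R n z -> weighted_deriv L F p.+1 z <=
    C * \big[Num.max/0]_(k < p.+1) weighted_deriv L F k z) ->
  exists r K : R, 1 < r /\ forall m z, unit_ball R n z ->
    (m`!%:R)^-1 * weighted_deriv L F m z * r ^+ m <=
      K * \big[Num.max/0]_(k < p.+1) weighted_deriv L F k z.
Proof.
move=> beta1 LQ anF C0 H; have beta0 : 0 < beta by lra.
have [lam [lam1 ratio]] := classQ_ratio (ltW beta0) LQ.
(* With [q = L w / L z], the factor [q^(p+1)] splits as [q^(p+1-k) q^k]: the first part is at most
   [lam^(p+1)], the second turns the weighted derivative at [w] into the modulus of [g k]. *)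
have [K [K0 growth]] := jet_growth p (C * lam ^+ p.+1) beta0.
have Lpos : forall z, unit_ball R n z -> 0 < L z by case: LQ.
exists ((1 + beta) / 2), K; split=> [|m z zB]; first by lra.
have L0 := Lpos _ zB; pose c : Cx R := ((L z)^-1)%:C.
have cc : cabs c = (L z)^-1 by rewrite cabs_real gtr0_norm ?invr_gt0.
pose g k s := c ^+ k * dirDn b k F (z + (s * c) *: b).
have sB s : cabs s < beta -> cabs (s * c) <= beta / L z.
  by move=> sb; rewrite cabsM cc ler_wpM2r ?invr_ge0 ?ltW.
have inB s : cabs s < beta -> unit_ball R n (z + (s * c) *: b).
  by move=> sb; apply: classQ_ball (ltW beta0) LQ zB (sB s sb).
have jet k x : cabs x < beta -> quad_diff (g k) x (g k.+1 x).
  by move=> xb; apply: slice_quad_diff anF (inB x xb).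
have gE k s : cabs (g k s) = (L z ^+ k)^-1 * cabs (dirDn b k F (z + (s * c) *: b)).
  by rewrite /g cabsM cabsX cc exprVn.
have g0 k : cabs (g k 0) = weighted_deriv L F k z.
  by rewrite gE mul0r scale0r addr0.
have {growth} bd := growth g jet.
have gle x : cabs x < beta ->
    cabs (g p.+1 x) <= C * lam ^+ p.+1 * \big[Num.max/0]_(k < p.+1) cabs (g k x).
  move=> xb; set w := z + (x * c) *: b.
  have Lw := Lpos _ (inB x xb); rewrite -/w in Lw.
  have rw : L w / L z <= lam by rewrite ler_pdivrMr// ratio ?sB.
  have rw0 : 0 < L w / L z by rewrite divr_gt0.
  have gw k : cabs (g k x) = (L w / L z) ^+ k * weighted_deriv L F k w.
    rewrite gE /weighted_deriv -/w exprMn exprVn; field.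
    by rewrite !expf_neq0// gt_eqF.
  rewrite gw; apply: le_trans (ler_wpM2l (exprn_ge0 _ (ltW rw0)) (H _ (inB x xb))) _.
  rewrite -/w mulrCA -mulrA ler_wpM2l ?(ltW C0)//.
  set M := \big[_/_]_(k < _) cabs _.
  have M0 : 0 <= M by exact: bigmax_ge_id.
  have lam0 : 0 <= lam ^+ p.+1 by rewrite exprn_ge0//; lra.
  rewrite mulrC -ler_pdivlMr ?exprn_gt0//.
  apply: bigmax_le => [|k _].
    by rewrite divr_ge0 ?mulr_ge0// exprn_ge0// ltW.
  rewrite ler_pdivlMr ?exprn_gt0//.
  have kp : (k <= p.+1)%N by rewrite ltnW.
  have -> : (L w / L z) ^+ p.+1 = (L w / L z) ^+ (p.+1 - k) * (L w / L z) ^+ k.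
    by rewrite -exprD subnK.
  rewrite mulrC -mulrA -gw.
  apply: ler_pM; rewrite ?cabs_ge0 ?exprn_ge0 ?(ltW rw0)//; last first.
    exact: (le_bigmax _ (fun k : 'I_p.+1 => cabs (g k x)) k).
  apply: (@le_trans _ _ (lam ^+ (p.+1 - k))).
    by rewrite lerXn2r ?nnegrE ?(ltW rw0)//; lra.
  by rewrite ler_weXn2l// leq_subr.
have {bd} bd := bd gle.
have r0 : 0 < (1 + beta) / 2 by lra.
have rb : (1 + beta) / 2 < beta by lra.
rewrite -g0 [_^-1 * _]mulrC.
rewrite (eq_bigr (fun k : 'I_p.+1 => cabs (g k 0))); last by move=> k _; rewrite g0.
apply: (@cauchy_estimate _ g _ _ _ m r0 rb jet) => x xr; apply: bd.
by rewrite xr.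
Qed.

End DirectionalIndex.

Theorem theorem10 (R : realType) (n : nat) (beta : R) (b : 'rV[Cx R]_n)
    (L : 'rV[Cx R]_n -> R) (F : 'rV[Cx R]_n -> Cx R)
    (beta_gt1 : 1 < beta) (b_neq0 : b != 0) (LQ : classQ b beta L)
    (F_analytic : analytic_in (unit_ball R n) F) :
  bounded_L_index b L F <->
  exists (p : nat) (C : R), 0 < C /\
    forall z : 'rV[Cx R]_n, unit_ball R n z ->
      cabs (((L z ^+ p.+1)^-1)%:C * dirDn b p.+1 F z) <=
      C * \big[Num.max/0]_(k < p.+1)
            cabs (((L z ^+ k)^-1)%:C * dirDn b k F z).
Proof.
have Lpos : forall z, unit_ball R n z -> 0 < L z by case: LQ.
have scaled k z : (k`!%:R * L z ^+ k)^-1 * cabs (dirDn b k F z) =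
    (k`!%:R)^-1 * weighted_deriv b L F k z.
  by rewrite invfM -mulrA.
split.
  move=> [m0 H]; exists m0, (m0.+1`!%:R); split; first by rewrite ltr0n fact_gt0.
  move=> z zB; rewrite weighted_derivE ?Lpos//.
  under eq_bigr => k _ do rewrite weighted_derivE ?Lpos//.
  apply: bounded_index_deriv_bound; first exact: Lpos.
  have := H m0.+1 z zB; rewrite scaled.
  by under eq_bigr => k _ do rewrite scaled.
move=> [p [C [C0 H]]].
have [|r [K [r1 HK]]] := deriv_bound_taylor (p := p) beta_gt1 LQ F_analytic C0.
  move=> z zB; have := H z zB; rewrite weighted_derivE ?Lpos//.
  by under eq_bigr => k _ do rewrite weighted_derivE ?Lpos//.
(* Nothing is known of the sign of [K], hence [|K|]. The factor [p!] is there because the weighted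
   derivatives of order [k <= p] are at most [k! M <= p! M]. *)
have [N HN] := exprn_unbounded (`|K| * p`!%:R) r1.
exists (p + N)%N => m z zB; have L0 := Lpos z zB; rewrite scaled.
under eq_bigr => k _ do rewrite scaled.
set M := \big[_/_]_(k < _) _.
have Mk k : (k <= p + N)%N -> (k`!%:R)^-1 * weighted_deriv b L F k z <= M.
  move=> kp; exact: (le_bigmax _ (fun k : 'I_(p + N).+1 =>
    (k`!%:R)^-1 * weighted_deriv b L F k z) (Ordinal (kp : (k < (p + N).+1)%N))).
(* Orders up to [p + N] occur in the maximum itself; beyond them [r ^+ m] exceeds [r ^+ N] and
   absorbs the constant. *)
have [/Mk//|mp] := leqP m (p + N).
have M0 : 0 <= M by exact: bigmax_ge_id.
have r0 : 0 < r by lra.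
have rm : `|K| * p`!%:R <= r ^+ m.
  apply: le_trans HN _; rewrite ler_weXn2l ?(ltW r1)//.
  by apply: ltnW; apply: leq_ltn_trans mp; exact: leq_addl.
have := HK m z zB; rewrite -ler_pdivlMr ?exprn_gt0// => /le_trans; apply.
rewrite ler_pdivrMr ?exprn_gt0// [M * _]mulrC.
apply: (@le_trans _ _ (`|K| * p`!%:R * M)); last by rewrite ler_wpM2r.
rewrite -mulrA; apply: (@le_trans _ _
    (`|K| * \big[Num.max/0]_(k < p.+1) weighted_deriv b L F k z)).
  by rewrite ler_wpM2r ?ler_norm// bigmax_ge_id.
rewrite ler_wpM2l//; apply: bigmax_le => [|k _]; first by rewrite mulr_ge0.
have kp : (k <= p)%N by rewrite -ltnS.
have := Mk k (leq_trans kp (leq_addr _ _)).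
rewrite ler_pdivrMl ?ltr0n ?fact_gt0// => /le_trans; apply.
by rewrite ler_wpM2r// ler_nat leq_fact.
Qed.
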